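(* Let $\{\mathcal{P}_n\}_{n=1}^\infty$ be a sequence of pyramids converging weakly to a pyramid $\mathcal{P}$, and let $N$ be a natural number ($N\ge1$). Then the following (1) and (2) are equivalent to each other. (1) $\{\mathcal{P}_n\}$ is an $N$-Lévy family. (2) There exists a finite extended mm-space $X$ with $\#X\le N$ such that $\mathcal{P}=\mathcal{P}_X$.
   Context: An mm-space is a triple $(X,d_X,\mu_X)$ with $(X,d_X)$ a complete separable metric space and $\mu_X$ a Borel probability measure; we always assume $X=\operatorname{supp}\mu_X$. $\mathcal{X}$ is the set of mm-isomorphism classes of mm-spaces (mm-isomorphism: measure-preserving isometry between supports). $Y\prec X$ means there is a $1$-Lipschitz map $f:X\to Y$ with $f_*\mu_X=\mu_Y$. An extended mm-space is defined in the same way as an mm-space except that the metric may take values in $[0,+\infty]$; the relation $\prec$ is defined in the same manner, and for an extended mm-space $X$, $\mathcal{P}_X=\{X'\in\mathcal{X}\mid X'\prec X\}$ (this is a pyramid). $\#X$ is the number of points of $X$. Box distance: a parameter of $X$ is a Borel map $\varphi:I=[0,1)\to X$ with $\varphi_*\mathcal{L}^1=\mu_X$. $\square(X,Y)$ is the infimum of $\varepsilon\ge0$ such that there are parameters $\varphi$ of $X$, $\psi$ of $Y$ and a Borel set $I_0\subset I$ with $\mathcal{L}^1(I_0)\ge1-\varepsilon$ and $|d_X(\varphi(s),\varphi(t))-d_Y(\psi(s),\psi(t))|\le\varepsilon$ for all $s,t\in I_0$. It is a metric on $\mathcal{X}$. A pyramid is a nonempty $\square$-closed subset $\mathcal{P}\subset\mathcal{X}$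 such that (i) $X\in\mathcal{P}$ and $Y\prec X$ imply $Y\in\mathcal{P}$; (ii) for any $X,X'\in\mathcal{P}$ there is $Y\in\mathcal{P}$ with $X\prec Y$, $X'\prec Y$. Weak convergence $\mathcal{P}_n\to\mathcal{P}$: $\lim_{n}\square(X,\mathcal{P}_n)=0$ for every $X\in\mathcal{P}$, and $\liminf_n\square(X,\mathcal{P}_n)>0$ for every $X\in\mathcal{X}\setminus\mathcal{P}$, where $\square(X,\mathcal{P}_n)=\inf_{Y\in\mathcal{P}_n}\square(X,Y)$. Separation distance: for an mm-space $X$ and $\kappa_0,\dots,\kappa_N>0$, $N\ge1$, $\operatorname{Sep}(X;\kappa_0,\dots,\kappa_N)$ is the supremum of $\min_{i\ne j}d_X(A_i,A_j)$ over Borel sets $A_0,\dots,A_N\subset X$ with $\mu_X(A_i)\ge\kappa_i$ for all $i$, where $d_X(A,B)=\inf_{x\in A,y\in B}d_X(x,y)$; it is $0$ if no such sets exist. For a pyramid, $\operatorname{Sep}(\mathcal{P};\kappa_0,\dots,\kappa_N)=\lim_{\delta\to0+}\sup_{X\in\mathcal{P}}\operatorname{Sep}(X;\kappa_0-\delta,\dots,\kappa_N-\delta)\in[0,+\infty]$. $\{\mathcal{P}_n\}$ is an $N$-Lévy family if $\lim_{n\to\infty}\operatorname{Sep}(\mathcal{P}_n;\kappa_0,\kappa_1,\dots,\kappa_N)=0$ for any $\kappa_0,\dots,\kappa_N>0$ with $\sum_{i=0}^N\kappa_i<1$. *)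

(* Defs.v *)
From HB Require Import structures.
From mathcomp Require Import all_boot all_order all_algebra.
From mathcomp Require Import all_classical all_reals all_analysis.

Set Implicit Arguments.
Unset Strict Implicit.
Unset Printing Implicit Defensive.

Import Order.TTheory GRing.Theory Num.Theory.
Import numFieldNormedType.Exports.

Local Open Scope classical_set_scope.
Local Open Scope ring_scope.
Local Open Scope ereal_scope.

Definition borel (T : ptopologicalType) := g_sigma_algebraType (@open T).

(* The possibly infinite metric is the library's [edist]; a pseudometric
   structure is an extended metric exactly when its topology is Hausdorff.
   Pointedness of the carrier is harmless: a space that carries a probability
   measure is nonempty, and no notion below depends on the chosen point. *)
Record extMmSpace (R : realType) := ExtMmSpace {
  emm_car :> completePseudoMetricType R ;
  emm_hausdorff : hausdorff_space emm_car ;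
  emm_separable : exists2 D : set emm_car, countable D & dense D ;
  emm_measure : probability (borel emm_car) R ;
  emm_full_support : forall U : set emm_car,
    open U -> U !=set0 -> 0 < emm_measure U
}.

Record mmSpace (R : realType) := MmSpace {
  mm_ext :> extMmSpace R ;
  mm_finite : forall x y : mm_ext, edist (x, y) < +oo
}.

Definition mm_dist (R : realType) (X : mmSpace R) (x y : X) : R :=
  fine (edist (x, y)).

(* [dominates X Y] is Y \prec X. *)
Definition dominates (R : realType) (X Y : extMmSpace R) : Prop :=
  exists f : X -> Y,
    (forall x y : X, edist (f x, f y) <= edist (x, y)) /\
    (forall B : set (borel Y), measurable B ->
       emm_measure X (f @^-1` B) = emm_measure Y B).

(* A map on I = [0,1) is represented by a map on R whose values outside I are
   ignored. *)
Definition is_parameter (R : realType) (X : extMmSpace R) (phi : R -> X)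
    : Prop :=
  measurable_fun (`[0%R, 1%R[ : set (measurableTypeR R))
    (phi : measurableTypeR R -> borel X) /\
  (forall B : set (borel X), measurable B ->
     lebesgue_measure (`[0%R, 1%R[ `&` phi @^-1` B) = emm_measure X B).

Definition box_le (R : realType) (X Y : mmSpace R) (e : R) : Prop :=
  exists (phi : R -> X) (psi : R -> Y) (I0 : set (measurableTypeR R)),
    [/\ is_parameter phi, is_parameter psi,
        measurable I0 /\ I0 `<=` `[0%R, 1%R[,
        (1 - e)%:E <= lebesgue_measure I0 &
        forall s t : R, I0 s -> I0 t ->
          (`|mm_dist (phi s) (phi t) - mm_dist (psi s) (psi t)| <= e)%R].

Definition box (R : realType) (X Y : mmSpace R) : \bar R :=
  ereal_inf [set e%:E | e in [set e : R | (0 <= e)%R /\ box_le X Y e]].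

(* A set of mm-isomorphism classes is a predicate on mm-spaces that is invariant
   under mm-isomorphism; for a pyramid, invariance follows from [pyr_down], since
   mm-isomorphic spaces dominate each other. The type [set (mmSpace R)] is ruled
   out by universe constraints of the library, [mmSpace R] being too large. *)
Definition mmClass (R : realType) := mmSpace R -> Prop.

Definition box_to_class (R : realType) (X : mmSpace R) (P : mmClass R)
    : \bar R :=
  ereal_inf [set r | exists Y : mmSpace R, P Y /\ r = box X Y].

Record is_pyramid (R : realType) (P : mmClass R) : Prop := IsPyramid {
  pyr_nonempty : exists X : mmSpace R, P X ;
  pyr_closed : forall X : mmSpace R,
    (forall e : R, (0 < e)%R ->
       exists Y : mmSpace R, P Y /\ box X Y < e%:E) -> P X ;
  pyr_down : forall X Y : mmSpace R, P X -> dominates X Y -> P Y ;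
  pyr_directed : forall X X' : mmSpace R, P X -> P X' ->
    exists Y : mmSpace R, [/\ P Y, dominates Y X & dominates Y X']
}.

Definition pyramid_of (R : realType) (X : extMmSpace R) : mmClass R :=
  fun X' : mmSpace R => dominates X X'.

Definition weakly_converges (R : realType) (Pn : nat -> mmClass R)
    (P : mmClass R) : Prop :=
  (forall X : mmSpace R, P X -> box_to_class X (Pn n) @[n --> \oo] --> 0) /\
  (forall X : mmSpace R, ~ P X ->
     0 < limn_einf (fun n => box_to_class X (Pn n))).

Definition set_dist (R : realType) (X : mmSpace R) (A B : set X) : \bar R :=
  ereal_inf [set edist (x, y) | x in A & y in B].

(* [maxe 0] only matters when no admissible family exists, the supremum of the
   empty set being -oo. *)
Definition Sep (R : realType) (N : nat) (X : mmSpace R)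
    (kappa : 'I_N.+1 -> R) : \bar R :=
  maxe 0 (ereal_sup
    [set \big[mine/+oo]_(p : 'I_N.+1 * 'I_N.+1 | p.1 != p.2)
           set_dist (A p.1) (A p.2)
    | A in [set A : 'I_N.+1 -> set (borel X) |
        forall i, measurable (A i) /\ (kappa i)%:E <= emm_measure X (A i)]]).

(* The limit exists: the function of delta is nondecreasing. *)
Definition pyramid_Sep (R : realType) (N : nat) (P : mmClass R)
    (kappa : 'I_N.+1 -> R) : \bar R :=
  lim (ereal_sup [set r | exists X : mmSpace R,
                    P X /\ r = Sep X (fun i => kappa i - delta)%R]
        @[delta --> (0%R : R)^'+]).

Definition levy_family (R : realType) (N : nat) (Pn : nat -> mmClass R)
    : Prop :=
  forall kappa : 'I_N.+1 -> R,
    (forall i, 0 < kappa i)%R -> (\sum_i kappa i < 1)%R ->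
    pyramid_Sep (Pn n) kappa @[n --> \oo] --> 0.

(* Main.v *)
(* (2) => (1): otherwise infinitely many P_n contain a space with N+1 sets of mass
   at least l at mutual distance more than e, and a 1-Lipschitz function into
   [0,e] is constant on these sets with distinct values. The quantile functions
   of its distributions are monotone, so they have, along an ultrafilter, a limit
   which is a limit for the box distance as well. The limit law lies in
   P = P_X and has at least N+1 points in its support, more than X has.

   (1) => (2): N+1 points of a space of P would be inherited by P_n as N+1
   separated sets, so all spaces in P have at most N points. Let Z in P have the
   maximal number of points. Every space in P is dominated by Z with a larger
   metric, by directedness. An increasing sequence of metrics on Z, chosen so as
   to maximize the sum of the (contracted) distances, converges to the extended
   metric of X. *)

From HB Require Import structures.
Require Import Defs.
From mathcomp Require Import all_boot all_order all_algebra.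
From mathcomp Require Import all_classical all_reals all_analysis.
From mathcomp Require Import measurable_realfun ring lra.

Set Implicit Arguments.
Unset Strict Implicit.
Unset Printing Implicit Defensive.

Import Order.TTheory GRing.Theory Num.Theory.
Import numFieldNormedType.Exports.

Local Open Scope classical_set_scope.
Local Open Scope ring_scope.
Local Open Scope ereal_scope.

(** * Spaces built from extended metrics and pushforward measures *)

(** A failure of the Levy property yields a new space for every index, while weak convergence tests
    the pyramids against one fixed space at a time. The spaces themselves may have no limit for the
    box distance; the laws of bounded functions on them correspond to monotone functions with values
    in one segment, where compactness is available. An ultrafilter containing all tails replaces a
    subsequence: pointwise limits exist at all points at once, and its sets meet every tail, which
    contradicts a positive lower limit. In the other direction the distances on [Z] may grow to
    infinity, so the limit metric is only an extended one, and both inclusions need an argument. A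
    space of [P] receives maps from [Z] that are 1-Lipschitz up to errors tending to 0, and
    finiteness makes one of them exact. A space dominated by the limit must be shrunk slightly
    before a finite stage dominates it. *)

Record emetric (R : realType) (T : Type) := EMetric {
  em_fun :> T -> T -> \bar R ;
  em_ge0 : forall x y, 0 <= em_fun x y ;
  em_xx : forall x, em_fun x x = 0 ;
  em_sym : forall x y, em_fun x y = em_fun y x ;
  em_triangle : forall x y z, em_fun x z <= em_fun x y + em_fun y z ;
  em_eq : forall x y, em_fun x y = 0 -> x = y ;
  em_complete : forall F : set_system T, ProperFilter F ->
    (forall r : R, (0 < r)%R -> exists x, F [set y | em_fun x y < r%:E]) ->
    exists l, forall r : R, (0 < r)%R -> F [set y | em_fun l y < r%:E]
}.

(** The metric is a parameter of the alias, so that different metrics on the same points carry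
    different topologies. *)
Definition emcar (R : realType) (T : pointedType) (d : emetric R T) : Type := T.

Section emcar_structure.
Context (R : realType) (T : pointedType) (d : emetric R T).

HB.instance Definition _ := Pointed.on (emcar d).

Let eball (x : emcar d) (r : R) : set (emcar d) := [set y | d x y < r%:E].

Let ent : set_system (emcar d * emcar d) := entourage_ eball.

HB.instance Definition _ := hasNbhs.Build (emcar d) (nbhs_ ent).

Let eball_center (x : emcar d) (r : R) : (0 < r)%R -> eball x r x.
Proof. by move=> r0; rewrite /eball /= em_xx lte_fin. Qed.

Let eball_sym (x y : emcar d) (r : R) : eball x r y -> eball y r x.
Proof. by rewrite /eball /= em_sym. Qed.

Let eball_triangle (x y z : emcar d) (r1 r2 : R) :
  eball x r1 y -> eball y r2 z -> eball x (r1 + r2)%R z.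
Proof.
rewrite /eball /= => xy yz; apply: le_lt_trans (em_triangle d x y z) _.
by rewrite EFinD lteD.
Qed.

HB.instance Definition _ := @Nbhs_isPseudoMetric.Build R (emcar d)
  ent erefl eball eball_center eball_sym eball_triangle erefl.

Lemma emcar_ballE (x : emcar d) (r : R) : ball x r = [set y | d x y < r%:E].
Proof. by []. Qed.

Let emcar_cauchy_cvg (F : set_system (emcar d)) :
  ProperFilter F -> cauchy F -> cvg F.
Proof.
move=> FF /cauchyP Fc.
have [l Fl] := em_complete FF (fun r r0 => Fc r r0).
by apply/cvg_ex; exists l; apply/cvg_ballP => r r0; exact: Fl.
Qed.

HB.instance Definition _ := Uniform_isComplete.Build (emcar d) emcar_cauchy_cvg.

End emcar_structure.

Section emetric_space.
Context (R : realType) (T : pointedType) (d : emetric R T).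

(** The library's [edist] is the infimum of the radii of balls joining the two points; no such
    radius exists when [d x y] is infinite. *)
Lemma edist_emcar (x y : emcar d) : edist (x, y) = d x y.
Proof.
apply/eqP; rewrite eq_le; apply/andP; split.
- case E : (d x y) => [r||]; last by have := em_ge0 d x y; rewrite E.
    apply/lee_addgt0Pr => e e0; have r0 : (0 <= r)%R by rewrite -lee_fin -E em_ge0.
    rewrite -EFinD; apply: edist_fin; first by rewrite ltr_wpDl.
    by rewrite emcar_ballE /= E lte_fin ltrDl.
  by rewrite leey.
- apply: le_ereal_inf_tmp => _ [r [r0 /=]] xy <-.
  by move: xy; rewrite emcar_ballE => /ltW.
Qed.

Lemma emcar_ball_open (x : emcar d) (r : R) : open [set y : emcar d | d x y < r%:E].
Proof.
rewrite openE => y /= xy; rewrite /interior.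
have [s s0 ds] : exists2 s : R, (0 < s)%R & d x y + s%:E < r%:E.
  move: xy (em_ge0 d x y); case: (d x y) => // a; rewrite lte_fin => ar _.
  by exists ((r - a) / 2)%R; rewrite ?lte_fin; lra.
apply: (@filterS _ _ _ (ball y s)); last exact: nbhsx_ballx.
move=> z; rewrite !emcar_ballE /= => yz.
apply: le_lt_trans (em_triangle d x y z) _; apply: le_lt_trans _ ds.
by rewrite leeD2l // ltW.
Qed.

Lemma emcar_hausdorff : hausdorff_space (emcar d).
Proof.
move=> x y xy; apply: (@em_eq _ _ d); apply/eqP; rewrite eq_le em_ge0 andbT.
apply/lee_addgt0Pr => e e0; rewrite add0e.
have e20 : (0 < e / 2)%R by rewrite divr_gt0.
have [z []] := xy _ _ (nbhsx_ballx x _ e20) (nbhsx_ballx y _ e20).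
rewrite !emcar_ballE /= [d y z]em_sym => xz zy.
apply: le_trans (em_triangle d x z y) _.
by rewrite (splitr e) EFinD leeD // ltW.
Qed.

End emetric_space.

Section push_space.
Context (R : realType) (T : pointedType) (d : emetric R T).
Context (disp : measure_display) (Om : measurableType disp).
Context (m : probability Om R) (phi : Om -> emcar d).
Hypothesis phi_meas : forall U : set (emcar d), open U -> measurable (phi @^-1` U).
Hypothesis phi_supp : forall x (r : R), (0 < r)%R ->
  0 < m (phi @^-1` [set y | d x y < r%:E]).
Hypothesis car_sep : exists2 D : set (emcar d), countable D & dense D.

Lemma push_measurable : measurable_fun [set: Om] (phi : Om -> borel (emcar d)).
Proof.
apply: (@measurability _ _ Om (borel (emcar d)) setT phi (@open (emcar d))) => //.
by move=> _ [U oU <-]; rewrite setTI; exact: phi_meas.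
Qed.

Let phi_mfun : {mfun Om >-> borel (emcar d)} :=
  HB.pack (phi : Om -> borel (emcar d)) (isMeasurableFun.Build _ _ _ _ _ push_measurable).

Definition push_measure : probability (borel (emcar d)) R :=
  distribution m phi_mfun.

Lemma push_full_support (U : set (emcar d)) :
  open U -> U !=set0 -> 0 < push_measure U.
Proof.
move=> oU [x Ux].
have /nbhs_ballP[r /= r0 rU] : nbhs x U by move: oU; rewrite openE; exact.
apply: lt_le_trans (phi_supp x r0) _; apply: le_measure.
- by rewrite inE; apply: phi_meas; exact: emcar_ball_open.
- by rewrite inE; exact: phi_meas.
- by move=> w; exact: rU.
Qed.

(** This serves for the law of a quantile function, with [phi] defined on the line, and for a finite
    space with a new metric, with [phi] the identity. *)
Definition push_space : extMmSpace R :=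
  ExtMmSpace (emcar_hausdorff (d := d)) car_sep push_full_support.

End push_space.

(** * Lebesgue measure on the unit interval *)

Section unit_interval.
Context (R : realType).

Definition unitI : set R := `[0%R, 1%R[.

Lemma measurable_unitI : measurable (unitI : set (measurableTypeR R)).
Proof. exact: measurable_itv. Qed.

(** A measure on the whole line that charges only [0,1), to match parameters, which are maps on
    [R]. *)
Definition leb01 : set (measurableTypeR R) -> \bar R :=
  mrestr (@lebesgue_measure R) measurable_unitI.

HB.instance Definition _ := Measure.on leb01.

Let leb01T : leb01 setT = 1.
Proof.
rewrite /leb01 /mrestr setTI /unitI lebesgue_measure_itv /= lte_fin ltr01.
by rewrite oppr0 adde0.
Qed.

HB.instance Definition _ := Measure_isProbability.Build _ _ _ leb01 leb01T.

Lemma leb01E (A : set R) : leb01 A = lebesgue_measure (unitI `&` A).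
Proof. by rewrite /leb01 /mrestr setIC. Qed.

Lemma leb01_itv (a b : R) : (0 <= a)%R -> (a <= b)%R -> (b <= 1)%R ->
  leb01 `[a, b[%classic = (b - a)%:E.
Proof.
move=> a0 ab b1; rewrite leb01E.
have -> : unitI `&` `[a, b[%classic = `[a, b[%classic.
  apply/seteqP; split => x /=; rewrite /unitI /= !in_itv /=; first by case.
  by move=> /andP[? ?]; split; lra.
rewrite lebesgue_measure_itv /= lte_fin; case: ltP => // ba.
by congr EFin; lra.
Qed.

End unit_interval.

(* Right-continuity puts every value of [qt] on [0,1) in the support of the
   distribution of [qt]. *)
Record quantile (R : realType) := Quantile {
  qt :> R -> R ;
  qt_nd : forall s t : R, (0 <= s)%R -> (s <= t)%R -> (t < 1)%R -> (qt s <= qt t)%R ;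
  qt_rc : forall s : R, (0 <= s < 1)%R -> forall e : R, (0 < e)%R ->
    exists2 t, (s < t < 1)%R & (qt t < qt s + e)%R
}.

(** * The mm-space of a quantile function *)

Section quantile_space.
Context (R : realType) (q : quantile R).

(** Taking the closure makes the carrier complete. *)
Definition qsupp : set R := closure (q @` @unitI R).

Definition qcar := {x : R | x \in qsupp}.

HB.instance Definition _ := SubType.on qcar.
HB.instance Definition _ := Choice.on qcar.

Lemma qsuppP (s : R) : unitI s -> q s \in qsupp.
Proof. by move=> Is; rewrite inE; apply: subset_closure; exists s. Qed.

Lemma unitI0 : unitI (0%R : R).
Proof. by rewrite /unitI /= in_itv /= lexx ltr01. Qed.

Definition qpt0 : qcar := exist _ (q 0%R) (qsuppP unitI0).

HB.instance Definition _ := isPointed.Build qcar qpt0.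

Definition qdist (x y : qcar) : \bar R := `|val x - val y|%:E.

Let qdist_complete (F : set_system qcar) : ProperFilter F ->
  (forall r : R, (0 < r)%R -> exists x, F [set y | qdist x y < r%:E]) ->
  exists l, forall r : R, (0 < r)%R -> F [set y | qdist l y < r%:E].
Proof.
move=> FF Fc.
have : cvg ((val : qcar -> R) @ F).
  apply: cauchy_cvg; apply: cauchy_exP => r r0.
  have [x Fx] := Fc _ r0; exists (val x).
  by apply: (@filterS _ F _ _ _ _ Fx) => y; rewrite /= /qdist lte_fin.
move=> /cvg_ex[l /= Fl].
have ql : l \in qsupp.
  rewrite inE /qsupp; apply: (@closed_cvg _ _ F _ (val : qcar -> R) qsupp) => //.
  - exact: closed_closure.
  - by apply: filterE => y; rewrite -in_setE; exact: valP.
exists (exist _ l ql) => r r0; move/cvg_ballP: Fl => /(_ _ r0).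
by apply: filterS => y; rewrite /qdist /= lte_fin.
Qed.

Definition qmetric : emetric R qcar.
Proof.
apply: (@EMetric R qcar qdist) => //.
- by move=> x y; rewrite lee_fin.
- by move=> x; rewrite /qdist subrr normr0.
- by move=> x y; rewrite /qdist distrC.
- by move=> x y z; rewrite /qdist -EFinD lee_fin ler_distD.
- by move=> x y [/eqP]; rewrite normr_eq0 subr_eq0 => /eqP/val_inj.
Defined.

(** Outside [0,1) the values of [q] are arbitrary and may leave [qsupp], hence the default
    [qpt0]. *)
Definition qparam (s : R) : emcar qmetric :=
  if pselect (unitI s) is left Is then exist _ (q s) (qsuppP Is) else qpt0.

Lemma val_qparam (s : R) : unitI s -> val (qparam s : qcar) = q s.
Proof. by rewrite /qparam; case: pselect. Qed.

Lemma qt_ndI (s t : R) : unitI s -> unitI t -> (s <= t)%R -> (q s <= q t)%R.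
Proof.
by rewrite /unitI /= !in_itv /= => /andP[? ?] /andP[? ?] ?; exact: qt_nd.
Qed.

(** By monotonicity the preimage of a ray is an interval. *)
Lemma qt_measurable :
  measurable_fun (@unitI R) (q : measurableTypeR R -> measurableTypeR R).
Proof.
apply: (measurability (@RGenCInfty.G R)) => [|/= _ [_ [r ->] <-]].
  exact: RGenCInfty.measurableE.
apply: is_interval_measurable => s t [Is qs] [It qt] u /andP[su ut].
have Iu : unitI u.
  move: Is It; rewrite /unitI /= !in_itv /= => /andP[? ?] /andP[? ?].
  by apply/andP; split; lra.
split=> //; move: qs; rewrite /= !in_itv /= !andbT => /le_trans -> //.
exact: qt_ndI.
Qed.

Lemma open_qcarE (U : set (emcar qmetric)) : open U ->
  exists2 V : set R, open V & U = [set x | V (val (x : qcar))].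
Proof.
move=> oU; exists [set x | exists2 r : R, (0 < r)%R &
    forall y : qcar, (`|val y - x| < r)%R -> U y].
  rewrite openE => x [r r0 rU]; apply/nbhs_ballP; exists (r / 2)%R => /=.
    by rewrite divr_gt0.
  move=> z xz; exists (r / 2)%R; first by rewrite divr_gt0.
  move=> y yz; apply: rU; rewrite (splitr r).
  apply: le_lt_trans (ler_distD z _ _) _.
  by apply: ltrD => //; move: xz; rewrite /ball /= distrC.
apply/seteqP; split => x /=.
  move=> Ux; have /nbhs_ballP[r /= r0 rU] : nbhs x U by move: oU; rewrite openE; exact.
  exists r => // y yx; apply: rU.
  by rewrite emcar_ballE /= /qdist lte_fin distrC.
by move=> [r r0 rU]; apply: rU; rewrite subrr normr0.
Qed.

(** The traces of Borel sets of the line form a sigma-algebra that contains the open sets.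
    Identities between measures on the space thereby reduce to the line. *)
Lemma borel_qcarE (B : set (borel (emcar qmetric))) : measurable B ->
  exists2 V : set (measurableTypeR R), measurable V & B = [set x | V (val (x : qcar))].
Proof.
have : @measurable _ (borel (emcar qmetric)) `<=` [set A | exists2 V,
    @measurable _ (measurableTypeR R) V & A = [set x | V (val (x : qcar))]];
  last exact.
apply: smallest_sub.
  split.
  - by exists set0; [exact: measurable0|].
  - move=> A [V mV ->]; exists (~` V); first exact: measurableC.
    by apply/seteqP; split=> x /=; [case|split].
  - move=> F mF; have /choice[V VP] : forall i, exists V, measurable V /\
        F i = [set x | V (val (x : qcar))] by move=> i; have [V ? ?] := mF i; exists V.
    exists (\bigcup_i (V i)).
      by apply: bigcupT_measurable => i; have [] := VP i.
    apply/seteqP; split=> x [i _] Vi; exists i => //; have [_ E] := VP i.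
      by move: Vi; rewrite E.
    by rewrite E.
move=> U /open_qcarE[V oV ->]; exists V => //; exact: open_measurable.
Qed.

Lemma qparam_open (U : set (emcar qmetric)) : open U ->
  measurable (qparam @^-1` U : set (measurableTypeR R)).
Proof.
move=> /open_qcarE[V oV UE].
have -> : qparam @^-1` U =
    (@unitI R `&` q @^-1` V) `|` (~` @unitI R `&` [set _ | U qpt0]).
  apply/seteqP; split=> s /=.
    have [Is|nIs] := pselect (unitI s).
      by rewrite UE /= val_qparam //; left.
    by rewrite /qparam; case: pselect => // ?; right.
  case=> [[Is qs]|[nIs Up]]; first by rewrite UE /= val_qparam.
  by rewrite /qparam; case: pselect.
apply: measurableU.
  by apply: qt_measurable; [exact: (@measurable_unitI R)|exact: open_measurable oV].
apply: measurableI; first exact: (measurableC (@measurable_unitI R)).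
have [H|H] := pselect (U qpt0).
  rewrite (_ : [set _ | U qpt0] = setT); first exact: measurableT.
  by apply/seteqP; split.
rewrite (_ : [set _ | U qpt0] = set0); first exact: measurable0.
by apply/seteqP; split.
Qed.

(** A point of the closure is within [r / 2] of some [q s], and [q] rises by less than [r / 2] on an
    interval [[s, t[] of positive length. *)
Lemma qparam_supp (x : emcar qmetric) (r : R) : (0 < r)%R ->
  0 < @leb01 R (qparam @^-1` [set y | qmetric x y < r%:E]).
Proof.
move=> r0; have r20 : (0 < r / 2)%R by rewrite divr_gt0.
have : qsupp (val (x : qcar)) by have := valP (x : qcar); rewrite inE.
move=> /(_ _ (nbhsx_ballx _ _ r20)) [_ [[s Is <-]]] xs.
have s01 : (0 <= s < 1)%R by move: Is; rewrite /unitI /= in_itv.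
have [t /andP[st t1] qts] := qt_rc q s01 r20.
apply: (@lt_le_trans _ _ (leb01 `[s, t[%classic)).
  by rewrite leb01_itv ?lte_fin; move: s01 => /andP[? ?]; lra.
apply: le_measure; rewrite ?inE.
- exact: measurable_itv.
- by apply: qparam_open; exact: emcar_ball_open.
move=> u /=; rewrite in_itv /= => /andP[su ut]; rewrite lte_fin.
have Iu : unitI u.
  by rewrite /unitI /= in_itv /=; apply/andP; move: s01 => /andP[? ?]; split; lra.
have It : unitI t.
  by rewrite /unitI /= in_itv /=; apply/andP; move: s01 => /andP[? ?]; split; lra.
rewrite val_qparam //.
have := qt_ndI Is Iu su; have := qt_ndI Iu It (ltW ut).
by move: xs; rewrite /ball /= ltr_norml ltr_norml => /andP[? ?] ? ?; apply/andP; split; lra.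
Qed.

(** Values at rational arguments are dense: an interval on which [q] stays close to [q s] contains a
    rational. *)
Lemma qcar_separable : exists2 D : set (emcar qmetric), countable D & dense D.
Proof.
exists [set qparam (ratr a) | a in [set: rat]].
  by apply: (sub_countable (card_image_le _ _)); exact: countableP.
move=> U [x Ux] oU.
have /nbhs_ballP[r /= r0 rU] : nbhs x U by move: oU; rewrite openE; exact.
have r20 : (0 < r / 2)%R by rewrite divr_gt0.
have : qsupp (val (x : qcar)) by have := valP (x : qcar); rewrite inE.
move=> /(_ _ (nbhsx_ballx _ _ r20)) [_ [[s Is <-]]] xs.
have s01 : (0 <= s < 1)%R by move: Is; rewrite /unitI /= in_itv.
have [t /andP[st t1] qts] := qt_rc q s01 r20.
have [a] := rat_in_itvoo st; rewrite in_itv /= => /andP[sa at_].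
exists (qparam (ratr a)); split; last by exists a.
apply: rU; rewrite emcar_ballE /= lte_fin.
have Iu : unitI (ratr a : R).
  by rewrite /unitI /= in_itv /=; apply/andP; move: s01 => /andP[? ?]; split; lra.
have It : unitI t.
  by rewrite /unitI /= in_itv /=; apply/andP; move: s01 => /andP[? ?]; split; lra.
rewrite val_qparam //.
have := qt_ndI Is Iu (ltW sa); have := qt_ndI Iu It (ltW at_).
by move: xs; rewrite /ball /= ltr_norml ltr_norml => /andP[? ?] ? ?; apply/andP; split; lra.
Qed.

Definition qspace_ext : extMmSpace R :=
  push_space (m := @leb01 R) qparam_open qparam_supp qcar_separable.

Lemma qspace_measureE (B : set (borel qspace_ext)) :
  emm_measure qspace_ext B = leb01 (qparam @^-1` B).
Proof. by []. Qed.

Lemma qspace_finite (x y : qspace_ext) : edist (x, y) < +oo.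
Proof. by rewrite (edist_emcar (d := qmetric)) ltry. Qed.

Definition qspace : mmSpace R := MmSpace qspace_finite.

Lemma qspace_dist (s t : R) : unitI s -> unitI t ->
  mm_dist (qparam s : qspace) (qparam t) = `|q s - q t|%R.
Proof.
by move=> Is It; rewrite /mm_dist (edist_emcar (d := qmetric)) /= /qdist !val_qparam.
Qed.

Lemma qparam_parameter : is_parameter (qparam : R -> qspace).
Proof.
split; last by move=> B mB; rewrite -leb01E.
apply: measurable_funTS.
apply: (@push_measurable R qcar qmetric _ (measurableTypeR R) qparam).
exact: qparam_open.
Qed.

End quantile_space.

(** * Quantile functions *)

Section quantile_of_function.
Context (R : realType) (disp : measure_display) (Om : measurableType disp).
Context (m : probability Om R) (f : Om -> measurableTypeR R) (M : R).
Hypothesis f_meas : measurable_fun setT f.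
Hypothesis f_bnd : forall w, (0 <= f w <= M)%R.

(** The distribution function with strict inequality is left-continuous. Its generalized inverse [q]
    below is then the right-continuous one. *)
Let G (t : R) : R := fine (m (f @^-1` `]-oo, t[%classic)).

Let Gm (t : R) : measurable (f @^-1` `]-oo, t[%classic).
Proof. by rewrite -[X in measurable X]setTI; exact: f_meas. Qed.

Let GE (t : R) : (G t)%:E = m (f @^-1` `]-oo, t[%classic).
Proof. by rewrite /G fineK // fin_num_measure. Qed.

Let G_nd (s t : R) : (s <= t)%R -> (G s <= G t)%R.
Proof.
move=> st; rewrite -lee_fin !GE; apply: le_measure; rewrite ?inE //.
by move=> w /=; rewrite !in_itv /= => /lt_le_trans; exact.
Qed.

Let G_le1 (t : R) : (G t <= 1)%R.
Proof. by rewrite -lee_fin GE probability_le1. Qed.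

Let G0 (t : R) : (t <= 0)%R -> G t = 0%R.
Proof.
move=> t0; apply/EFin_inj; rewrite GE.
rewrite (_ : _ @^-1` _ = set0) ?measure0 //.
apply/seteqP; split=> w //=; rewrite in_itv /= => ft.
by have /andP[f0 _] := f_bnd w; lra.
Qed.

Let G1 (t : R) : (M < t)%R -> G t = 1%R.
Proof.
move=> Mt; apply/EFin_inj; rewrite GE.
rewrite (_ : _ @^-1` _ = setT) ?probability_setT //.
apply/seteqP; split=> w //= _; rewrite in_itv /=.
by have /andP[_ fM] := f_bnd w; lra.
Qed.

Let M0 : (0 <= M)%R.
Proof.
rewrite leNgt; apply/negP => M0.
have := probability_setT m; rewrite (_ : setT = set0) ?measure0 => [/eqP|].
  by rewrite eq_sym onee_eq0.
by apply/seteqP; split=> w // _; have := f_bnd w; lra.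
Qed.

Let E (s : R) : set R := [set t | (0 <= t <= M)%R /\ (G t <= s)%R].

Let q (s : R) : R := sup (E s).

Let E_ub (s : R) : ubound (E s) M.
Proof. by move=> t [/andP[]]. Qed.

Let E0 (s : R) : (0 <= s)%R -> E s 0%R.
Proof. by move=> s0; rewrite /E /= lexx M0 G0. Qed.

Let q_bnd (s : R) : (0 <= q s <= M)%R.
Proof.
have [s0|s0] := leP 0%R s.
  apply/andP; split; first by apply: ub_le_sup; [exists M|exact: E0].
  by apply: ge_sup; [exists 0%R; exact: E0|].
rewrite /q (_ : E s = set0) ?sup0 ?lexx ?M0 //.
apply/seteqP; split=> t // [_ Gs].
have : (0 <= G t)%R by rewrite -lee_fin GE.
lra.
Qed.

(** The supremum defining [q s] is attained: [m] is continuous from below along the events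
    [f w < q s - 1/(n+1)], and each of these has mass at most [s]. *)
Let Gq (s : R) : (0 <= s)%R -> (G (q s) <= s)%R.
Proof.
move=> s0; rewrite -lee_fin GE.
pose F n := f @^-1` `]-oo, (q s - n.+1%:R^-1)%R[%classic.
have Fcvg : m \o F @ \oo --> m (\bigcup_n F n).
  apply: nondecreasing_cvg_mu.
  - by move=> n; exact: Gm.
  - by apply: bigcupT_measurable => n; exact: Gm.
  - move=> i j ij; apply/subsetPset => w; rewrite /F /= !in_itv /= => /lt_le_trans; apply.
    by rewrite lerD2l lerN2 lef_pV2 ?posrE // ler_nat.
rewrite (_ : f @^-1` _ = \bigcup_n F n); last first.
  apply/seteqP; split=> w /=.
    rewrite in_itv /= => fq.
    have /ltr_add_invr[n] := fq; rewrite -ltrBrDr => ?.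
    by exists n => //; rewrite /F /= in_itv.
  move=> [n _]; rewrite /F /= !in_itv /= => /lt_trans; apply.
  by rewrite ltrBlDr ltrDl invr_gt0.
rewrite -(cvg_lim _ Fcvg) //; apply: lime_le; first by apply/cvg_ex; eexists; exact: Fcvg.
apply: nearW => n; rewrite /= -GE lee_fin.
have [e [_ Ge] qe] : exists2 e, E s e & (q s - n.+1%:R^-1 < e)%R.
  by apply: sup_adherent; [rewrite invr_gt0|split; [exists 0%R; exact: E0|exists M]].
by apply: le_trans Ge; exact/G_nd/ltW.
Qed.

Let le_q (s t : R) : (0 <= s)%R -> (0 <= t <= M)%R -> (t <= q s)%R = (G t <= s)%R.
Proof.
move=> s0 t0; apply/idP/idP => [tq|Gs].
  exact: le_trans (G_nd tq) (Gq s0).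
by apply: ub_le_sup; [exists M|].
Qed.

Let q_nd (s t : R) : (s <= t)%R -> (q s <= q t)%R.
Proof.
have [s0 st|s0 _] := leP 0%R s.
  rewrite le_q ?q_bnd // ?(le_trans s0) //.
  exact: le_trans (Gq s0) st.
rewrite [q s](_ : _ = 0%R); first by have /andP[] := q_bnd t.
rewrite /q (_ : E s = set0) ?sup0 //.
apply/seteqP; split=> u // [_ Gs].
have : (0 <= G u)%R by rewrite -lee_fin GE.
lra.
Qed.

(** If [q s + e] lies in the range, then [s < G (q s + e)], and any [t] strictly between these two
    numbers has [q t < q s + e]. Otherwise the bound [M] suffices. *)
Let q_rc (s : R) : (0 <= s < 1)%R -> forall e : R, (0 < e)%R ->
  exists2 t, (s < t < 1)%R & (q t < q s + e)%R.
Proof.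
move=> /andP[s0 s1] e e0; have [qsM|Mqs] := leP (q s + e)%R M; last first.
  exists ((s + 1) / 2)%R; first by apply/andP; split; lra.
  by apply: le_lt_trans Mqs; have /andP[] := q_bnd ((s + 1) / 2)%R.
have qs0 : (0 <= q s + e <= M)%R.
  by have /andP[? ?] := q_bnd s; apply/andP; split; lra.
have sG : (s < G (q s + e))%R by rewrite ltNge -le_q // -ltNge ltrDl.
have G1' := G_le1 (q s + e).
exists ((s + G (q s + e)) / 2)%R; first by apply/andP; split; lra.
by rewrite ltNge le_q // -?ltNge; lra.
Qed.

(** It suffices to compare the two laws on rays. For [0 < t <= M] and [s] in [0,1), [q s < t] means
    [s < G t], and [0, [G t]) has length [G t]. *)
Lemma exists_quantile : exists q : quantile R,
  (forall s, 0 <= q s <= M)%R /\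
  forall C : set (measurableTypeR R), measurable C ->
    leb01 (q @^-1` C) = m (f @^-1` C).
Proof.
exists (Quantile (fun s t _ st _ => q_nd st) q_rc); split; first exact: q_bnd.
have q_meas : measurable_fun setT (q : measurableTypeR R -> measurableTypeR R).
  by apply: nondecreasing_measurable => // s t; exact: q_nd.
pose mq : {mfun measurableTypeR R >-> measurableTypeR R} :=
  HB.pack (q : measurableTypeR R -> measurableTypeR R)
    (isMeasurableFun.Build _ _ _ _ _ q_meas).
pose mf : {mfun Om >-> measurableTypeR R} :=
  HB.pack f (isMeasurableFun.Build _ _ _ _ _ f_meas).
move=> C mC /=.
apply: (@measure_unique _ R (measurableTypeR R) (@RGenInftyO.G R)
  (fun n => `]-oo, n%:R[%classic) (RGenInftyO.measurableE R) _ _ _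
  (distribution (@leb01 R) mq) (distribution m mf)) => //.
- move=> _ _ [a ->] [b ->]; exists (Num.min a b); apply/seteqP; split => x /=.
    by rewrite !in_itv /= lt_min => -[-> ->].
  by rewrite !in_itv /= lt_min => /andP.
- by move=> n; exists n%:R.
- apply/seteqP; split => // x _; exists (Num.bound `|x|%R) => //=.
  by rewrite in_itv /= (le_lt_trans (ler_norm _)) // archi_boundP.
- move=> _ [t ->].
  change (leb01 (q @^-1` `]-oo, t[%classic) = m (f @^-1` `]-oo, t[%classic)).
  rewrite -GE.
  have [t0|t0] := leP t 0%R.
    rewrite G0 // (_ : _ @^-1` _ = set0) ?measure0 //.
    apply/seteqP; split=> s //=; rewrite in_itv /=.
    by have := q_bnd s; lra.
  have [tM|Mt] := leP t M; last first.
    rewrite G1 // (_ : _ @^-1` _ = setT) ?probability_setT //.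
    apply/seteqP; split=> s //= _; rewrite in_itv /=.
    by have := q_bnd s; lra.
  have Gt0 : (0 <= G t)%R by rewrite -(G0 (lexx 0%R)); exact/G_nd/ltW.
  rewrite -[in RHS](subr0 (G t)) -leb01_itv // !leb01E; congr (lebesgue_measure _).
  apply/seteqP; split=> s; rewrite /unitI /= !in_itv /= => -[/andP[s0 s1] sG].
    by split; [apply/andP|rewrite s0 ltNge -le_q -?ltNge ?tM ?andbT // ltW].
  split; first by apply/andP.
  by rewrite ltNge le_q -?ltNge ?tM ?andbT ?(ltW t0) //; case/andP: sG.
- move=> k; apply: (le_lt_trans _ (ltry 1)); apply: probability_le1.
  exact: measurable_itv.
Qed.

End quantile_of_function.

(** * Laws of bounded 1-Lipschitz functions *)

Section lipschitz_image.
Context (R : realType) (Y : extMmSpace R) (f : Y -> R) (M : R).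
Hypothesis f_lip : forall x y, `|f x - f y|%:E <= edist (x, y).
Hypothesis f_bnd : forall y, (0 <= f y <= M)%R.

Lemma lipschitz_continuous : continuous (f : Y -> R).
Proof.
move=> x; apply/cvg_ballP => r r0.
have r20 : (0 < r / 2)%R by rewrite divr_gt0.
apply: (@filterS _ _ _ (ball x (r / 2))); last exact: nbhsx_ballx.
move=> y xy; rewrite /ball /=.
have : `|f x - f y|%:E <= (r / 2)%:E.
  by apply: le_trans (f_lip x y) _; exact: edist_fin.
by rewrite lee_fin; lra.
Qed.

Lemma lipschitz_measurable :
  measurable_fun setT (f : borel Y -> measurableTypeR R).
Proof.
apply: (@measurability _ _ (borel Y) (measurableTypeR R) setT f _
  (RGenOpens.measurableE R)) => _ [_ [a [b ->]] <-].
rewrite setTI; apply: sub_sigma_algebra; apply: open_comp; last exact: interval_open.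
by move=> x _; exact: lipschitz_continuous.
Qed.

(** The map [f] itself gives the domination. Its values lie in [qsupp q]: a ball around [f y] that
    [q] misses on [0,1) would have mass zero, but its preimage under [f] is open and nonempty. *)
Lemma exists_quantile_space : exists q : quantile R,
  [/\ forall s, (0 <= q s <= M)%R, dominates Y (qspace q) &
   forall C : set (measurableTypeR R), measurable C ->
    leb01 (q @^-1` C) = emm_measure Y (f @^-1` C)].
Proof.
have [q [q_bnd qE]] := exists_quantile (emm_measure Y) lipschitz_measurable f_bnd.
exists q; split => //.
have fs y : f y \in qsupp q.
  rewrite inE => U /nbhs_ballP[r /= r0 rU].
  apply: contrapT => H.
  have : leb01 (q @^-1` ball (f y) r) = 0.
    rewrite leb01E (_ : _ `&` _ = set0) ?measure0 //.
    apply/seteqP; split=> s // [Is qs]; apply: H; exists (q s).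
    by split; [exists s|exact: rU].
  have oB : open (ball (f y) r : set R) by exact: ball_open.
  rewrite qE; last exact: open_measurable.
  move=> /eqP; rewrite gt_eqF //; apply: emm_full_support.
    by apply: open_comp => // x _; exact: lipschitz_continuous.
  by exists y; exact: ballxx.
exists (fun y => exist _ (f y) (fs y) : qspace q); split.
  by move=> x y; rewrite (edist_emcar (d := qmetric q)); exact: f_lip.
move=> B mB; have [C mC BE] := borel_qcarE mB.
rewrite (qspace_measureE (q := q)) BE -[LHS](qE _ mC) !leb01E; congr (lebesgue_measure _).
by apply/seteqP; split=> s [Is] /=; rewrite val_qparam.
Qed.

End lipschitz_image.

(** * Box distance and ultralimits of quantile functions *)

Section quantile_limit.
Context (R : realType).

(** With the quantile functions as parameters, a distance between two points changes by at most the
    sum of the errors at its endpoints. *)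
Lemma box_le_quantile (p q : quantile R) (e : R) (I0 : set R) :
  measurable (I0 : set (measurableTypeR R)) -> I0 `<=` @unitI R ->
  (1 - e)%:E <= lebesgue_measure I0 ->
  (forall s, I0 s -> `|p s - q s| <= e / 2)%R ->
  box_le (qspace p) (qspace q) e.
Proof.
move=> mI0 I0I leI0 pq.
exists (qparam p), (qparam q), I0; split => //; try exact: qparam_parameter.
move=> s t Is It; rewrite !qspace_dist; try exact: I0I.
have := ler_normB (p s - q s)%R (p t - q t)%R.
have := pq _ Is; have := pq _ It.
have : (`| `|p s - p t| - `|q s - q t| | <= `|(p s - p t) - (q s - q t)|)%R.
  exact: ler_dist_dist.
have -> : ((p s - p t) - (q s - q t) = (p s - q s) - (p t - q t))%R by ring.
lra.
Qed.

Let grid (n k : nat) : R := (k%:R / n.+1%:R)%R.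

Lemma grid_itvP (n : nat) (s : R) : (0 <= s < 1)%R ->
  exists2 k, (k < n.+1)%N & (grid n k <= s < grid n k.+1)%R.
Proof.
move=> /andP[s0 s1]; have n0 : (0 < n.+1%:R :> R)%R by rewrite ltr0n.
have /truncn_itv/andP[k1 k2] : (0 <= s * n.+1%:R)%R by rewrite mulr_ge0.
exists (Num.trunc (s * n.+1%:R)).
  by rewrite -(ltr_nat R); apply: le_lt_trans k1 _; rewrite gtr_pMl.
by rewrite /grid ler_pdivrMr // ltr_pdivlMr // k1.
Qed.

Lemma grid_ge0 (n k : nat) : (0 <= grid n k)%R.
Proof. by rewrite divr_ge0. Qed.

Lemma grid_le1 (n k : nat) : (k <= n.+1)%N -> (grid n k <= 1)%R.
Proof. by move=> kn; rewrite ler_pdivrMr ?ltr0n // mul1r ler_nat. Qed.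

Lemma grid_lt1 (n k : nat) : (k < n.+1)%N -> (grid n k < 1)%R.
Proof. by move=> kn; rewrite ltr_pdivrMr ?ltr0n // mul1r ltr_nat. Qed.

Lemma gridS (n k : nat) : (grid n k.+1 = grid n k + n.+1%:R^-1)%R.
Proof. by rewrite /grid -natr1 mulrDl mul1r. Qed.

(* At most [M / eta] cells of the grid carry a jump larger than [eta]; the last
   cell is discarded too, since [q] is not controlled at 1. *)
Lemma small_jump_cells (q : R -> R) (M eta : R) (n : nat) :
  (forall s t, 0 <= s -> s <= t -> t < 1 -> q s <= q t)%R ->
  (forall s, 0 <= s < 1 -> 0 <= q s <= M)%R -> (0 < eta)%R ->
  exists I0 : set (measurableTypeR R), [/\ measurable I0, I0 `<=` @unitI R,
    (1 - (M / eta + 1) / n.+1%:R)%:E <= lebesgue_measure I0 &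
    forall s, I0 s -> exists k, [/\ (k < n)%N, (grid n k <= s < grid n k.+1)%R &
      (q (grid n k.+1) - q (grid n k) <= eta)%R]].
Proof.
move=> q_nd q_bnd eta0.
pose good k := (k < n)%N && (q (grid n k.+1) - q (grid n k) <= eta)%R.
pose cell k : set (measurableTypeR R) := `[grid n k, grid n k.+1[%classic.
pose cI k := if good k then cell k else set0.
pose cJ k := if good k then set0 else cell k.
pose I0 : set (measurableTypeR R) := \big[setU/set0]_(k < n.+1) cI k.
pose J0 : set (measurableTypeR R) := \big[setU/set0]_(k < n.+1) cJ k.
have mcell k : measurable (cell k) by exact: measurable_itv.
have mI0 : measurable I0 by apply: bigsetU_measurable => k _; rewrite /cI; case: ifP.
have mcJ k : measurable (cJ k) by rewrite /cJ; case: ifP.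
have mJ0 : measurable J0 by apply: bigsetU_measurable => k _.
have n0 : (0 < n.+1%:R :> R)%R by rewrite ltr0n.
have grid_mono k : (grid n k <= grid n k.+1)%R by rewrite gridS lerDl invr_ge0 ltW.
have I0P s : I0 s -> exists k, [/\ (k < n.+1)%N, good k & cell k s].
  rewrite /I0 -bigcup_mkord => -[k /= kn]; rewrite /cI; case: ifP => // gk sk.
  by exists k.
have I0I : I0 `<=` @unitI R.
  move=> s /I0P[k [kn _]]; rewrite /cell /unitI /= !in_itv /= => /andP[ks sk].
  by rewrite (le_trans (grid_ge0 n k)) //= (lt_le_trans sk) // grid_le1.
exists I0; split=> //; last first.
  move=> s /I0P[k [_ /andP[kn qk]]]; rewrite /cell /= in_itv /= => ks.
  by exists k.
have lebJ0 : leb01 J0 <= ((M / eta + 1) / n.+1%:R)%:E.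
  apply: le_trans (Boole_inequality _ _) _; first by move=> k _; exact: mcJ.
  apply: (@le_trans _ _ (\sum_(k < n.+1) ((~~ good k)%:R / n.+1%:R)%:E)).
    apply: lee_sum => k _; rewrite /cJ; case: ifP => gk /=.
      by rewrite measure0 lee_fin divr_ge0.
    rewrite leb01_itv ?grid_ge0 ?grid_mono ?grid_le1 //.
    by rewrite gridS lee_fin mul1r addrC addKr.
  rewrite sumEFin lee_fin -mulr_suml ler_pM2r ?invr_gt0 //.
  rewrite -(ler_pM2r eta0) mulrDl divfK ?gt_eqF // mul1r mulr_suml.
  rewrite big_ord_recr /= {2}/good ltnn /= mul1r lerD2r.
  have q0 : (0 <= grid n 0 < 1)%R by rewrite grid_ge0 grid_lt1.
  have qn : (0 <= grid n n < 1)%R by rewrite grid_ge0 grid_lt1.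
  have : (\sum_(0 <= k < n) (q (grid n k.+1) - q (grid n k)) <= M)%R.
    rewrite (telescope_sumr (fun k => q (grid n k)) (leq0n n)).
    by move: (q_bnd _ q0) (q_bnd _ qn); lra.
  rewrite big_mkord; apply: le_trans; apply: ler_sum => k _.
  rewrite /good ltn_ord /=; case: (leP _ eta) => /= [_|/ltW]; rewrite ?mul1r // mul0r.
  by rewrite subr_ge0 q_nd ?grid_ge0 ?grid_lt1 // ltnS.
have : 1 <= leb01 I0 + leb01 J0.
  apply: le_trans (measureU2 _ mI0 mJ0).
  have <- : leb01 (@unitI R) = 1.
    by rewrite /unitI leb01_itv ?subr0 ?lexx.
  apply: le_measure; rewrite ?inE; [exact: measurable_unitI|exact: measurableU|].
  move=> s; rewrite /unitI /= in_itv /= => /(grid_itvP n)[k kn ks].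
  have [gk|gk] := boolP (good k).
    by left; rewrite /I0 -bigcup_mkord; exists k => //; rewrite /cI gk /cell /= in_itv.
  right; rewrite /J0 -bigcup_mkord; exists k => //.
  by rewrite /cJ (negbTE gk) /cell /= in_itv.
rewrite [leb01 I0]leb01E (setIidr I0I) => le1.
have := le_trans le1 (leeD2l _ lebJ0).
by rewrite -leeBlDr // -EFinB.
Qed.

Section ultralimit.
Context (U : set_system nat) (UU : UltraFilter U).
Context (qs : nat -> quantile R) (M : R).
Hypothesis qs_bnd : forall n s, (0 <= qs n s <= M)%R.

(** A cluster point in the compact segment is a limit, because an ultrafilter contains every set or
    its complement. *)
Let pointwise_limit : exists q0 : R -> R,
  (forall s, (0 <= q0 s <= M)%R) /\ (forall s, qs n s @[n --> U] --> q0 s).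
Proof.
suff H : forall s, exists l, (0 <= l <= M)%R /\ qs n s @[n --> U] --> l.
  have [q0 q0P] := choice H.
  by exists q0; split=> s; case: (q0P s).
move=> s; pose F := fmap (fun n => qs n s) U.
have FA : F `[0%R, M]%classic.
  by apply: (@filterE _ U) => n /=; rewrite in_itv /=; exact: qs_bnd.
have [l [l0M lF]] := @segment_compact R 0%R M F _ FA.
exists l; split; first by move: l0M; rewrite /= in_itv.
move=> V lV; have [//|nV] := in_ultra_setVsetC ((fun n => qs n s) @^-1` V) UU.
by have [x []] := lF (~` V) V nV lV.
Qed.

(** At the finitely many grid points the convergence is simultaneous. Inside a cell both [q] and
    [qs m] are squeezed by monotonicity between their bounds at the ends, which are close to each
    other unless [q0] has a large jump there. *)
Lemma ultralimit_quantile : exists q : quantile R, forall e : R, (0 < e)%R ->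
  U [set n | box_le (qspace q) (qspace (qs n)) e].
Proof.
have [q0 [q0_bnd q0_lim]] := pointwise_limit.
have q0_nd s t : (0 <= s)%R -> (s <= t)%R -> (t < 1)%R -> (q0 s <= q0 t)%R.
  move=> s0 st t1; apply: ler_cvg_to (q0_lim s) (q0_lim t) _.
  by apply: filterE => n; exact: qt_nd.
(* The pointwise limit need not be right-continuous: regularize it. *)
pose E s : set R := [set q0 t | t in [set t | s < t < 1]%R].
have E0 s : (s < 1)%R -> E s !=set0.
  move=> s1; exists (q0 ((s + 1) / 2)%R), ((s + 1) / 2)%R => //=.
  by apply/andP; split; lra.
have Elb s : lbound (E s) 0%R by move=> _ [t _ <-]; have /andP[] := q0_bnd t.
pose q s := inf (E s).
have le_q s t : (s < t < 1)%R -> (q s <= q0 t)%R.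
  by move=> st; apply: ge_inf; [exists 0%R|exists t].
have ge_q s : (0 <= s < 1)%R -> (q0 s <= q s)%R.
  move=> /andP[s0 s1]; apply: lb_le_inf; first exact: E0.
  by move=> _ [t /= /andP[st t1] <-]; apply: q0_nd => //; exact: ltW.
have q_nd s t : (0 <= s)%R -> (s <= t)%R -> (t < 1)%R -> (q s <= q t)%R.
  move=> s0 st t1; apply: lb_le_inf; first exact: E0.
  by move=> _ [u /= /andP[tu u1] <-]; apply: le_q; rewrite u1 (le_lt_trans st).
have q_rc s : (0 <= s < 1)%R -> forall e : R, (0 < e)%R ->
    exists2 t, (s < t < 1)%R & (q t < q s + e)%R.
  move=> /andP[s0 s1] e e0.
  have [_ [t /= /andP[st t1] <-] qt] : exists2 x, E s x & (x < q s + e)%R.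
    by apply: inf_adherent => //; split; [exact: E0|exists 0%R].
  exists ((s + t) / 2)%R; first by apply/andP; split; lra.
  by apply: le_lt_trans qt; apply: le_q; rewrite t1 andbT; lra.
exists (Quantile q_nd q_rc) => e e0.
have e80 : (0 < e / 8)%R by rewrite divr_gt0.
have M0 : (0 <= M)%R by have := qs_bnd 0 0%R; lra.
(* The grid is fine enough for the discarded cells to have total length at most [e]. *)
pose n := Num.bound ((M / (e / 8) + 1) / e)%R.
have [I0 [mI0 I0I leI0 I0P]] :=
  small_jump_cells n q0_nd (fun s _ => q0_bnd s) e80.
have : \forall m \near U, forall k : 'I_n.+1,
    (`|qs m (grid n k) - q0 (grid n k)| <= e / 8)%R.
  by apply: filter_forall => k; exact: cvgr_distC_le (q0_lim _) _ e80.
apply: filterS => m mP.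
apply: (@box_le_quantile (Quantile q_nd q_rc) (qs m) e I0) => //.
  apply: le_trans leI0; rewrite lee_fin lerD2l lerN2.
  rewrite ler_pdivrMr ?ltr0n // [leRHS]mulrC -ler_pdivrMr //.
  have nE : (0 <= (M / (e / 8) + 1) / e)%R.
    by rewrite divr_ge0 ?addr_ge0 ?divr_ge0 // ltW.
  by apply: le_trans (ltW (archi_boundP nE)) _; rewrite ler_nat.
move=> s Is; have [k [kn /andP[ks sk] jk]] := I0P _ Is.
have k0 := grid_ge0 n k; have k1 := grid_lt1 (kn : (k.+1 < n.+1)%N).
have s01 : (0 <= s < 1)%R by apply/andP; split; lra.
have := mP (Ordinal (ltnW (kn : (k.+1 < n.+1)%N))).
have := mP (Ordinal (kn : (k.+1 < n.+1)%N)) => /=.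
have : (qs m (grid n k) <= qs m s)%R by apply: qt_nd => //; lra.
have : (qs m s <= qs m (grid n k.+1))%R by apply: qt_nd => //; lra.
have : (q0 (grid n k) <= q s)%R.
  by apply: le_trans (ge_q _ s01); apply: q0_nd => //; lra.
have : (q s <= q0 (grid n k.+1))%R by apply: le_q; rewrite sk.
by move=> ? ? ? ?; rewrite !ler_norml => /andP[? ?] /andP[? ?]; apply/andP; split; lra.
Qed.
End ultralimit.
End quantile_limit.

(** * Separation distance *)

Section ereal_sequences.
Context (R : realType).

Lemma exists_pos_lb (I : finType) (u : I -> R) : (forall i, 0 < u i)%R ->
  exists2 l : R, (0 < l)%R & forall i, (l <= u i)%R.
Proof.
move=> u0; exists (\big[Num.min/1%R]_i u i); last by move=> i; exact: bigmin_le_cond.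
by apply: lt_bigmin => // i _; exact: u0.
Qed.

Lemma cvge0P (u : nat -> \bar R) : (forall n, 0 <= u n) ->
  u n @[n --> \oo] --> 0 <->
  forall e : R, (0 < e)%R -> \forall n \near \oo, u n < e%:E.
Proof.
move=> u0; split.
  by move=> uc e e0; apply: (uc [set x | x < e%:E]); apply: open_ereal_lt'; rewrite lte_fin.
move=> ue; apply/fine_cvgP; split.
  near=> n; rewrite ge0_fin_numE //; apply: (@lt_trans _ _ 1%:E); last exact: ltry.
  by near: n; exact: ue.
apply/cvgrPdist_lt => e e0; near=> n.
have une : u n < e%:E by near: n; exact: ue.
have ufin : u n \is a fin_num by rewrite ge0_fin_numE // (lt_trans une) ?ltry.
rewrite sub0r normrN /= ger0_norm ?fine_ge0 //.
by rewrite -lte_fin fineK.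
Unshelve. all: by end_near. Qed.

Lemma limn_einf_gt0 (u : nat -> \bar R) : 0 < limn_einf u ->
  exists2 c : R, (0 < c)%R & \forall n \near \oo, c%:E <= u n.
Proof.
rewrite limn_einf_lim (cvg_lim _ (cvg_einfs_sup (u := u))) // => /ereal_sup_gt[_ [n _ <-]] un.
have [c c0 cu] : exists2 c : R, (0 < c)%R & c%:E <= einfs u n.
  move: un; case: (einfs u n) => [r||] //; first by rewrite lte_fin => r0; exists r.
  by exists 1%R => //; rewrite leey.
exists c => //; exists n => // m /= nm; apply: le_trans cu _.
by apply: ereal_inf_lbound; exists m.
Qed.

End ereal_sequences.

Section separation.
Context (R : realType) (N : nat).

Lemma Sep_ge0 (X : mmSpace R) (kappa : 'I_N.+1 -> R) : 0 <= Sep X kappa.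
Proof. by rewrite /Sep le_max lexx. Qed.

Lemma le_Sep (X : mmSpace R) (k1 k2 : 'I_N.+1 -> R) :
  (forall i, k1 i <= k2 i)%R -> Sep X k2 <= Sep X k1.
Proof.
move=> k12; rewrite /Sep ge_max le_max lexx /= le_max; apply/orP; right.
apply: ereal_sup_le => _ [A AP <-]; exists A => // i.
have [mA kA] := AP i; split => //; apply: le_trans kA.
by rewrite lee_fin.
Qed.

Lemma Sep_gtP (X : mmSpace R) (kappa : 'I_N.+1 -> R) (e : R) : (0 <= e)%R ->
  e%:E < Sep X kappa ->
  exists A : 'I_N.+1 -> set (borel X),
    (forall i, measurable (A i) /\ (kappa i)%:E <= emm_measure X (A i)) /\
    forall i j x y, i != j -> A i x -> A j y ->
      e%:E < edist (x : emm_car X, y : emm_car X).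
Proof.
move=> e0; rewrite /Sep lt_max => /orP[|/ereal_sup_gt[_ [A AP <-]]].
  by rewrite lte_fin => /(le_lt_trans e0); rewrite ltxx.
move=> /bigmin_gtP[_ Ae]; exists A; split=> // i j x y ij Ax Ay.
apply: lt_le_trans (Ae (i, j) ij) _; apply: ereal_inf_lbound.
by exists x => //; exists y.
Qed.

Lemma Sep_ge (X : mmSpace R) (kappa : 'I_N.+1 -> R) (e : R)
    (A : 'I_N.+1 -> set (borel X)) :
  (forall i, measurable (A i) /\ (kappa i)%:E <= emm_measure X (A i)) ->
  (forall i j x y, i != j -> A i x -> A j y ->
     e%:E <= edist (x : emm_car X, y : emm_car X)) ->
  e%:E <= Sep X kappa.
Proof.
move=> AP Ae; rewrite /Sep le_max; apply/orP; right.
apply: le_trans (ereal_sup_ubound _); last by exists A; [exact: AP|reflexivity].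
apply/bigmin_geP; split; first by rewrite leey.
move=> [i j] /= ij; apply: le_ereal_inf_tmp => _ [x Ax [y Ay <-]].
exact: Ae Ax Ay.
Qed.

Let supSep (P : mmClass R) (kappa : 'I_N.+1 -> R) (delta : R) : \bar R :=
  ereal_sup [set r | exists X : mmSpace R,
    P X /\ r = Sep X (fun i => kappa i - delta)%R].

Let supSep_nd (P : mmClass R) (kappa : 'I_N.+1 -> R) (s t : R) :
  (s <= t)%R -> supSep P kappa s <= supSep P kappa t.
Proof.
move=> st; apply: ge_ereal_sup => _ [X [PX ->]].
apply: le_trans (ereal_sup_ubound _); last by exists X; split; [exact: PX|reflexivity].
by apply: le_Sep => i; lra.
Qed.

Let supSep_cvg (P : mmClass R) (kappa : 'I_N.+1 -> R) :
  cvg (supSep P kappa delta @[delta --> 0%R^'+]).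
Proof.
by apply: nondecreasing_at_right_is_cvge; apply: nearW => d s t _ _; exact: supSep_nd.
Qed.

Lemma pyramid_Sep_ge (P : mmClass R) (kappa : 'I_N.+1 -> R) (X : mmSpace R) :
  P X -> Sep X kappa <= pyramid_Sep P kappa.
Proof.
move=> PX; apply: lime_ge; first exact: supSep_cvg.
near=> d; apply: le_trans (ereal_sup_ubound _); last first.
  by exists X; split; [exact: PX|reflexivity].
apply: le_Sep => i; rewrite lerBlDr lerDl.
by near: d; exact: nbhs_right_ge.
Unshelve. all: by end_near. Qed.

(** The supremum is nondecreasing in delta, so its limit at 0 is at most its value at [d]: lowering
    the masses by [d] yields an actual space. *)
Lemma pyramid_Sep_gt (P : mmClass R) (kappa : 'I_N.+1 -> R) (d : R) (c : \bar R) :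
  (0 < d)%R -> c < pyramid_Sep P kappa ->
  exists2 X, P X & c < Sep X (fun i => kappa i - d)%R.
Proof.
move=> d0 cP.
have : c < supSep P kappa d.
  apply: lt_le_trans cP _; apply: lime_le; first exact: supSep_cvg.
  near=> s; apply: supSep_nd; near: s; exact: nbhs_right_le.
by move=> /ereal_sup_gt[_ [X [PX ->]]] cX; exists X.
Unshelve. all: by end_near. Qed.

Lemma pyramid_Sep_ge0 (P : mmClass R) (kappa : 'I_N.+1 -> R) :
  is_pyramid P -> 0 <= pyramid_Sep P kappa.
Proof.
by case=> -[X PX] _ _ _; apply: le_trans (pyramid_Sep_ge kappa PX); exact: Sep_ge0.
Qed.

End separation.

Section separating_function.
Context (R : realType) (N : nat) (X : mmSpace R).

Lemma mm_distE (x y : X) : (mm_dist x y)%:E = edist (x, y).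
Proof. by rewrite /mm_dist fineK // ge0_fin_numE ?edist_ge0 // mm_finite. Qed.

Lemma mm_dist_ge0 (x y : X) : (0 <= mm_dist x y)%R.
Proof. by rewrite -lee_fin mm_distE edist_ge0. Qed.

Lemma mm_distxx (x : X) : mm_dist x x = 0%R.
Proof. by apply: EFin_inj; rewrite mm_distE edist_refl. Qed.

Lemma mm_dist_sym (x y : X) : mm_dist x y = mm_dist y x.
Proof. by rewrite /mm_dist edist_sym. Qed.

Lemma mm_dist_triangle (x y z : X) : (mm_dist x z <= mm_dist x y + mm_dist y z)%R.
Proof. by rewrite -lee_fin EFinD !mm_distE edist_triangle. Qed.

Context (A : 'I_N.+1 -> set X) (e : R).
Hypothesis e0 : (0 < e)%R.
Hypothesis A_sep : forall i j x y, i != j -> A i x -> A j y -> (e <= mm_dist x y)%R.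

Let c (i : nat) : R := (i%:R * (e / N.+1%:R))%R.

(* The McShane extension, truncated at [e], of the function equal to [c i] on [A i]. *)
Lemma separating_function : exists f : X -> R,
  [/\ forall x y, `|f x - f y|%:E <= edist (x, y),
      forall x, (0 <= f x <= e)%R &
      forall i x, A i x -> f x = c i].
Proof.
pose S x : set R := [set r | r = e \/ exists i a, A i a /\ r = (c i + mm_dist x a)%R].
have c0 i : (0 <= c i)%R by rewrite mulr_ge0 // divr_ge0 // ltW.
have ce (i : 'I_N.+1) : (c i <= e)%R.
  rewrite /c mulrC mulrAC ler_pdivrMr ?ltr0n // ler_wpM2l ?ltW //.
  by rewrite ltr_nat ltn_ord.
have S0 x : S x !=set0 by exists e; left.
have Slb x : lbound (S x) 0%R.
  move=> r [->|[i [a [_ ->]]]]; first exact: ltW.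
  by rewrite addr_ge0 ?mm_dist_ge0.
have Sinf x r : S x r -> (inf (S x) <= r)%R by apply: ge_inf; exists 0%R.
have f_le x y : (inf (S x) - mm_dist x y <= inf (S y))%R.
  apply: lb_le_inf => // r [->|[i [a [Aa ->]]]].
    have := Sinf x e (or_introl erefl); have := mm_dist_ge0 x y; lra.
  have : S x (c i + mm_dist x a)%R by right; exists i, a.
  move=> /Sinf; have := mm_dist_triangle x y a; lra.
exists (fun x => inf (S x)); split.
- move=> x y; rewrite -mm_distE lee_fin ler_norml; apply/andP; split.
    by have := f_le y x; rewrite mm_dist_sym; lra.
  by have := f_le x y; lra.
- move=> x; rewrite Sinf ?andbT; last by left.
  exact: lb_le_inf.
- move=> i x Ax; apply/eqP; rewrite eq_le; apply/andP; split.
    by apply: Sinf; right; exists i, x; rewrite mm_distxx addr0.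
  apply: lb_le_inf => // r [->|[j [a [Aa ->]]]]; first exact: ce.
  have [->|ij] := eqVneq i j; first by rewrite lerDl mm_dist_ge0.
  have := A_sep ij Ax Aa; have := c0 j; have := ce i; lra.
Qed.

End separating_function.

(** * Limits with finitely many points *)

Section domination.
Context (R : realType).

Lemma finite_closed (X : extMmSpace R) (A : set X) : finite_set A -> closed A.
Proof.
by move: A; apply/accessible_finite_set_closed/hausdorff_accessible; exact: emm_hausdorff.
Qed.

(* The complement of the image is open of measure zero, hence empty. *)
Lemma dominates_surj (X Y : extMmSpace R) (f : X -> Y) :
  finite_set (range f) ->
  (forall B : set (borel Y), measurable B ->
    emm_measure X (f @^-1` B) = emm_measure Y B) ->
  forall y, exists x, f x = y.
Proof.
move=> fin fE y; apply: contrapT => ny.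
have oC : open (~` range f) by rewrite openC; exact: finite_closed.
have : 0 < emm_measure Y (~` range f).
  by apply: emm_full_support => //; exists y => -[x _ xy]; apply: ny; exists x.
rewrite -fE; last exact: sub_sigma_algebra.
rewrite (_ : f @^-1` _ = set0) ?measure0 ?ltxx //.
by apply/seteqP; split => x //= H; apply: H; exists x.
Qed.

(** The dominating map is onto, so distinct points of [Y] lift to distinct points of [X]. *)
Lemma card_le_dominates (X Y : extMmSpace R) (N : nat) (z : 'I_N.+1 -> Y) :
  ([set: X] #<= `I_N)%card -> dominates X Y -> ~ injective z.
Proof.
move=> XN [f [_ fE]] z_inj.
have Xfin : finite_set [set: X].
  by apply: (card_le_finite XN); exact: finite_II.
have f_surj := dominates_surj (finite_image f Xfin) fE.
have [g gE] := choice (fun i => f_surj (z i)).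
have g_inj : injective g by move=> i j gij; apply: z_inj; rewrite -!gE gij.
have : ([set: 'I_N.+1] #<= `I_N)%card.
  apply: card_le_trans XN; apply/pcard_injP; exists g => i j _ _; exact: g_inj.
by rewrite -(card_le_eql (@card_II N.+1)) card_le_II ltnn.
Qed.
End domination.

Section finite_limit_levy.
Context (R : realType).

Lemma leb01_meet (A I0 : set (measurableTypeR R)) (l e : R) :
  measurable A -> measurable I0 -> (e < l)%R -> l%:E <= leb01 A ->
  (1 - e)%:E <= leb01 I0 -> exists s, A s /\ I0 s.
Proof.
move=> mA mI0 el lA eI0; apply: contrapT => H.
have AI0 : A `&` I0 = set0.
  by apply/seteqP; split => s // -[As Is]; apply: H; exists s.
have : leb01 (A `|` I0) <= 1 by apply: probability_le1; exact: measurableU.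
rewrite measureU // => le1.
have := le_trans (leeD lA eI0) le1.
by rewrite -EFinD lee_fin; lra.
Qed.

Lemma quantile_with_atoms (N : nat) (Y : mmSpace R) (A : 'I_N.+1 -> set Y) (e l : R) :
  (0 < e)%R ->
  (forall i, @measurable _ (borel Y) (A i) /\ l%:E <= emm_measure Y (A i)) ->
  (forall i j x y, i != j -> A i x -> A j y -> e%:E < edist (x, y)) ->
  exists q : quantile R, [/\ forall s, (0 <= q s <= e)%R, dominates Y (qspace q) &
    forall i : 'I_N.+1, l%:E <= leb01 (q @^-1` [set (i%:R * (e / N.+1%:R))%R])].
Proof.
move=> e0 AP Ae.
have [|f [f_lip f_bnd fA]] := @separating_function R N Y A e e0.
  by move=> i j x y ij Ax Ay; rewrite -lee_fin mm_distE; apply/ltW/(Ae i j).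
have [q [q_bnd Yq qE]] := exists_quantile_space f_lip f_bnd.
exists q; split=> // i; rewrite qE; last exact: measurable_set1.
have [mA lA] := AP i; apply: le_trans lA _; apply: le_measure; rewrite ?inE //.
  rewrite -[X in measurable X]setTI.
  exact: (lipschitz_measurable f_lip measurableT (measurable_set1 _)).
by move=> x Ax /=; rewrite (fA i).
Qed.

Lemma box_le_ub (X Y : mmSpace R) (e : R) : (0 <= e)%R -> box_le X Y e -> box X Y <= e%:E.
Proof. by move=> e0 XY; apply: ereal_inf_lbound; exists e. Qed.

Lemma box_to_class_le (X Y : mmSpace R) (P : mmClass R) (e : R) :
  (0 <= e)%R -> P Y -> box_le X Y e -> box_to_class X P <= e%:E.
Proof.
move=> e0 PY XY; apply: le_trans (box_le_ub e0 XY).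
by apply: ereal_inf_lbound; exists Y.
Qed.

(** The points of the limit law are found at a single index [k]: each atom of the approximating law
    is reached at a parameter value in [I0], and the parameter of the limit sends these N+1 values
    to distinct points. *)
Lemma levy_of_finite (Pn : nat -> mmClass R) (P : mmClass R) (N : nat)
    (X : extMmSpace R) :
  (forall n, is_pyramid (Pn n)) -> weakly_converges Pn P ->
  ([set: X] #<= `I_N)%card -> (forall Y : mmSpace R, P Y -> dominates X Y) ->
  levy_family N Pn.
Proof.
move=> hPn [_ hconv] XN PX kappa k0 _.
have u0 n : 0 <= pyramid_Sep (Pn n) kappa by exact: pyramid_Sep_ge0.
apply/(cvge0P u0) => e e0.
apply: contrapT => H.
have e20 : (0 < e / 2)%R by rewrite divr_gt0.
have [l l0 lk] := exists_pos_lb k0.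
(* One half of [l] pays for the delta in the separation distance of a pyramid, the other half
   remains as the mass of each atom. *)
have l20 : (0 < l / 2)%R by rewrite divr_gt0.
have bad k : exists n, (k <= n)%N /\ (e / 2)%:E < pyramid_Sep (Pn n) kappa.
  apply: contrapT => nb; apply: H; exists k => // n /= kn.
  apply: (@le_lt_trans _ _ (e / 2)%:E); last by rewrite lte_fin; lra.
  by rewrite leNgt; apply/negP => ?; apply: nb; exists n.
have good k : exists nq : nat * quantile R, [/\ (k <= nq.1)%N,
    forall s, (0 <= nq.2 s <= e / 2)%R, Pn nq.1 (qspace nq.2) &
    forall i : 'I_N.+1,
      (l / 2)%:E <= leb01 (nq.2 @^-1` [set (i%:R * (e / 2 / N.+1%:R))%R])].
  have [n [kn Sn]] := bad k.
  have [Y PY SY] := pyramid_Sep_gt l20 Sn.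
  have [A [AP Ae]] := Sep_gtP (ltW e20) SY.
  have [|q [q_bnd Yq qA]] := @quantile_with_atoms N Y A (e / 2) (l / 2) e20 _ Ae.
    move=> i; have [mA kA] := AP i; split => //; apply: le_trans kA.
    by rewrite lee_fin; have := lk i; lra.
  by exists (n, q); split => //=; apply: pyr_down Yq; [exact: hPn|].
have [nq nqP] := choice good.
have [U [UU oU]] := ultraFilterLemma (eventually_filter : ProperFilter \oo).
have qs_bnd k s : (0 <= (nq k).2 s <= e / 2)%R by case: (nqP k).
have [q qP] := ultralimit_quantile UU qs_bnd.
(* Otherwise the box distance to [Pn] stays above some [c] from an index [n0] on, whereas the
   ultrafilter supplies a later index within [c / 2]. *)
have Pq : P (qspace q).
  apply: contrapT => /hconv /limn_einf_gt0[c c0 [n0 _ cP]].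
  have c20 : (0 < c / 2)%R by rewrite divr_gt0.
  have : U ([set k | (n0 <= k)%N] `&`
      [set k | box_le (qspace q) (qspace (nq k).2) (c / 2)]).
    by apply: filterI (qP _ c20); apply: oU; exists n0.
  move=> /filter_ex[k [/= n0k qk]].
  have [kn _ PY _] := nqP k.
  have := le_trans (cP _ (leq_trans n0k kn)) (box_to_class_le (ltW c20) PY qk).
  by rewrite lee_fin; lra.
have XZ := PX _ Pq.
pose d : R := (e / 2 / N.+1%:R)%R.
have d0 : (0 < d)%R by rewrite divr_gt0.
(* Since [r < l / 2], every atom meets [I0], whose measure is at least [1 - r]; since [r < d],
   different atoms cannot come from one point of the limit. *)
pose r : R := (Num.min (l / 4) (d / 2))%R.
have r0 : (0 < r)%R by rewrite lt_min !divr_gt0.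
have [k [phi [psi [I0 [_ psiP [mI0 I0I] rI0 box_r]]]]] := filter_ex (qP _ r0).
have [_ _ _ qA] := nqP k.
have rl : (r < l / 2)%R.
  by apply: (@le_lt_trans _ _ (l / 4)%R); [rewrite ge_min lexx|lra].
have rd : (r < d)%R.
  by apply: (@le_lt_trans _ _ (d / 2)%R); [rewrite ge_min lexx orbT|lra].
have hit (i : 'I_N.+1) : exists s, I0 s /\ val (psi s : qcar (nq k).2) = (i%:R * d)%R.
  pose C : set (measurableTypeR R) := [set (i%:R * d)%R].
  pose B : set (borel (qspace (nq k).2)) := [set x | C (val (x : qcar (nq k).2))].
  have mB : measurable B.
    rewrite -[B]setTI.
    apply: (@lipschitz_measurable R (qspace (nq k).2) (fun x => val (x : qcar _))) => //.
      by move=> x y; rewrite (edist_emcar (d := qmetric _)).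
    exact: measurable_set1.
  have mpsi : measurable (@unitI R `&` psi @^-1` B).
    exact: (psiP.1 (@measurable_unitI R) B mB).
  have [||s [[_ sB] I0s]] := @leb01_meet (@unitI R `&` psi @^-1` B) I0 (l / 2) r mpsi mI0 rl.
  - rewrite leb01E setIA setIid psiP.2 // (qspace_measureE (q := (nq k).2)).
    apply: le_trans (qA i) _; rewrite !leb01E.
    rewrite (_ : _ `&` (nq k).2 @^-1` _ = @unitI R `&` qparam (nq k).2 @^-1` B) //.
    by apply/seteqP; split=> t [It] /=; rewrite /B /= val_qparam.
  - by rewrite leb01E (setIidr I0I).
  by exists s.
have [s sP] := choice hit.
apply: (@card_le_dominates _ X (qspace q) N (fun i => phi (s i)) XN XZ).
move=> i j /= ij.
have [Ii si] := sP i; have [Ij sj] := sP j.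
have := box_r _ _ Ii Ij; rewrite ij mm_distxx sub0r normrN ger0_norm ?mm_dist_ge0 //.
rewrite /mm_dist (edist_emcar (d := qmetric _)) /= /qdist si sj -mulrBl normrM.
rewrite (gtr0_norm d0) => ijd.
have : (`|i%:R - j%:R : R| < 1)%R.
  by rewrite -(ltr_pM2r d0) mul1r; exact: le_lt_trans ijd rd.
rewrite ltr_norml => /andP[ij1 ij2].
have ij' : (i <= j)%N by rewrite -ltnS -(ltr_nat R) -natr1; lra.
have ji' : (j <= i)%N by rewrite -ltnS -(ltr_nat R) -natr1; lra.
by apply: ord_inj; apply/eqP; rewrite eqn_leq ij' ji'.
Qed.

End finite_limit_levy.

(** * Separation passes to nearby spaces *)

Section levy_limit_points.
Context (R : realType).

Lemma emm_eq (X : extMmSpace R) (x y : X) : edist (x, y) = 0 -> x = y.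
Proof. by move=> /edist_closeP; apply: close_eq; exact: emm_hausdorff. Qed.

Lemma leb01_setI (A I0 : set (measurableTypeR R)) (l e : R) :
  measurable A -> measurable I0 -> l%:E <= leb01 A -> (1 - e)%:E <= leb01 I0 ->
  (l - e)%:E <= leb01 (A `&` I0).
Proof.
move=> mA mI0 lA eI0.
have mA0 : measurable (A `&` I0) by exact: measurableI.
have A0fin : leb01 (A `&` I0) \is a fin_num by rewrite fin_num_measure.
have I0C : leb01 (~` I0) <= e%:E.
  rewrite [leLHS](_ : _ = 1 - leb01 I0); last exact: probability_setC.
  by rewrite leeBlDr ?fin_num_measure // addeC -leeBlDr // -EFinB.
have : leb01 A <= leb01 (A `&` I0) + e%:E.
  apply: (@le_trans _ _ (leb01 ((A `&` I0) `|` ~` I0))).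
    apply: le_measure; rewrite ?inE //; first by apply: measurableU => //; exact: measurableC.
    by move=> s As; have [|] := pselect (I0 s); [left|right].
  apply: le_trans (measureU2 _ mA0 (measurableC mI0)) _.
  exact: leeD2l.
by move=> /(le_trans lA); rewrite -leeBlDr // -EFinB.
Qed.

Lemma separated_balls (N : nat) (Z : mmSpace R) (z : 'I_N.+1 -> Z) :
  injective z -> exists D : R, exists l : R, [/\ (0 < D)%R, (0 < l)%R,
    forall i j, i != j -> (D <= mm_dist (z i) (z j))%R &
    forall i, l%:E <= emm_measure Z (interior (ball (z i) (D / 4)))].
Proof.
move=> z_inj.
(* The value 1 on the diagonal keeps the family positive, so that it has a positive lower bound. *)
have d0 (p : 'I_N.+1 * 'I_N.+1) :
    (0 < if p.1 == p.2 then 1 else mm_dist (z p.1) (z p.2))%R.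
  case: eqVneq => [|ij] //; rewrite lt_neqAle mm_dist_ge0 andbT.
  apply: contra_neq ij => /esym dz; apply: z_inj; apply: emm_eq.
  by rewrite -mm_distE dz.
have [D D0 Dz] := exists_pos_lb d0.
have D40 : (0 < D / 4)%R by rewrite divr_gt0.
have m0 i : (0 < fine (emm_measure Z (interior (ball (z i) (D / 4)))))%R.
  apply: fine_gt0; apply/andP; split; last first.
    apply: (le_lt_trans _ (ltry 1)); apply: probability_le1.
    by apply: sub_sigma_algebra; exact: open_interior.
  apply: emm_full_support; first exact: open_interior.
  by exists (z i); exact: nbhsx_ballx.
have [l l0 lz] := exists_pos_lb m0.
exists D, l; split => // [i j ij|i]; first by have := Dz (i, j); rewrite /= (negbTE ij).
rewrite -[leRHS]fineK ?lee_fin // fin_num_measure //.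
by apply: sub_sigma_algebra; exact: open_interior.
Qed.

(** The parameters carry the balls around the [z i] over to [Y], at a loss of mass [e]. The images
    need not be Borel and are thickened to open sets by balls of radius [D / 16]. Distances stay
    above [D - 2 (D/4) - D/16 - 2 (D/16)], which exceeds [D / 4]. *)
Lemma box_Sep_ge (N : nat) (Z Y : mmSpace R) (z : 'I_N.+1 -> Z) (D l e : R)
    (kappa : 'I_N.+1 -> R) : (0 < D)%R -> (0 <= e <= D / 16)%R ->
  (forall i j, i != j -> (D <= mm_dist (z i) (z j))%R) ->
  (forall i, l%:E <= emm_measure Z (interior (ball (z i) (D / 4)))) ->
  (forall i, kappa i <= l - e)%R ->
  box_le Z Y e -> (D / 4)%:E <= Sep Y kappa.
Proof.
move=> D0 /andP[e0 eD] Dz lz kl [phi [psi [I0 [phiP psiP [mI0 I0I] eI0 box_e]]]].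
have D160 : (0 < D / 16)%R by rewrite divr_gt0.
pose B i : set Z := interior (ball (z i) (D / 4)).
pose J i : set R := I0 `&` phi @^-1` B i.
pose A i : set (borel Y) := \bigcup_(s in J i) interior (ball (psi s) (D / 16)).
have oA i : open (A i : set Y) by apply: bigcup_open => s _; exact: open_interior.
have mB i : @measurable _ (borel Z) (B i).
  by apply: sub_sigma_algebra; exact: open_interior.
have mA i : measurable (A i) by apply: sub_sigma_algebra; exact: oA.
apply: (@Sep_ge R N Y kappa (D / 4) A) => [i|i j x y ij].
  split => //.
  rewrite -psiP.2 // -leb01E.
  have mphi : measurable (@unitI R `&` phi @^-1` B i).
    exact: (phiP.1 (@measurable_unitI R) _ (mB i)).
  have mpsi : measurable (@unitI R `&` psi @^-1` A i).
    exact: (psiP.1 (@measurable_unitI R) _ (mA i)).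
  have lphi : l%:E <= leb01 (@unitI R `&` phi @^-1` B i).
    by rewrite leb01E setIA setIid phiP.2; [exact: lz|exact: mB].
  have rI0 : (1 - e)%:E <= leb01 I0 by rewrite leb01E (setIidr I0I).
  have := leb01_setI mphi mI0 lphi rI0.
  move=> H; apply: le_trans (_ : (kappa i)%:E <= (l - e)%:E) _; first by rewrite lee_fin.
  apply: le_trans H _; rewrite [leRHS]leb01E.
  rewrite -[leRHS](_ : leb01 (@unitI R `&` psi @^-1` A i) = _); last first.
    by rewrite leb01E setIA setIid.
  apply: le_measure; rewrite ?inE //; first exact: measurableI.
  move=> s [[Is Bs] I0s]; split => //; exists s => //.
  exact: nbhsx_ballx.
move=> [s [I0s /interior_subset Bs] /interior_subset sx].
move=> [t [I0t /interior_subset Bt] /interior_subset ty].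
rewrite -mm_distE lee_fin.
have ballE (X : mmSpace R) (u v : X) (r : R) : (0 < r)%R -> ball u r v -> (mm_dist u v <= r)%R.
  by move=> r0 uv; rewrite -lee_fin mm_distE; exact: edist_fin.
have D40 : (0 < D / 4)%R by rewrite divr_gt0.
have := ballE _ _ _ _ D160 sx; have := ballE _ _ _ _ D160 ty.
have := ballE _ _ _ _ D40 Bs; have := ballE _ _ _ _ D40 Bt.
have := Dz _ _ ij; have := box_e _ _ I0s I0t; rewrite ler_norml => /andP[].
have := mm_dist_triangle (z i) (phi s) (z j).
have := mm_dist_triangle (phi s) (phi t) (z j).
have := mm_dist_triangle (psi s) x (psi t).
have := mm_dist_triangle x y (psi t).
rewrite (mm_dist_sym (phi t)) (mm_dist_sym y).
lra.
Qed.

Lemma box_to_class_ge0 (X : mmSpace R) (P : mmClass R) : 0 <= box_to_class X P.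
Proof.
apply: le_ereal_inf_tmp => _ [Y [_ ->]]; apply: le_ereal_inf_tmp => _ [e [e0 _] <-].
by rewrite lee_fin.
Qed.

Lemma card_levy_limit (Pn : nat -> mmClass R) (P : mmClass R) (N : nat)
    (Z : mmSpace R) (z : 'I_N.+1 -> Z) :
  (forall n, is_pyramid (Pn n)) -> weakly_converges Pn P -> levy_family N Pn ->
  P Z -> ~ injective z.
Proof.
move=> hPn [hconv _] hL PZ z_inj.
have [D [l [D0 l0 Dz lz]]] := separated_balls z_inj.
have l20 : (0 < l / 2)%R by rewrite divr_gt0.
(* The bound by the inverse of N+2 makes N+1 copies of [k] sum to less than 1; the bound [l / 2]
   leaves room for the loss of mass [e < l / 2]. *)
pose k : R := (Num.min (l / 2) (N.+2%:R^-1))%R.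
have k0 : (0 < k)%R by rewrite lt_min l20 invr_gt0 ltr0n.
have Sk : (\sum_(i < N.+1) k < 1)%R.
  rewrite sumr_const card_ord -mulr_natl.
  apply: (@le_lt_trans _ _ (N.+1%:R * N.+2%:R^-1)%R).
    by rewrite ler_wpM2l // ge_min lexx orbT.
  by rewrite ltr_pdivrMr ?ltr0n // mul1r ltr_nat.
pose r : R := (Num.min (D / 16) (l / 2))%R.
have r0 : (0 < r)%R by rewrite lt_min l20 divr_gt0.
have D40 : (0 < D / 4)%R by rewrite divr_gt0.
have S0 n : 0 <= pyramid_Sep (Pn n) (fun _ : 'I_N.+1 => k) by exact: pyramid_Sep_ge0.
have /(cvge0P S0) /(_ _ D40) SD := hL (fun _ => k) (fun _ => k0) Sk.
have b0 n : 0 <= box_to_class Z (Pn n) by exact: box_to_class_ge0.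
have /(cvge0P b0) /(_ _ r0) bD := hconv _ PZ.
have [n [/= Sn bn]] := filter_ex (filterI SD bD).
move: bn => /ereal_inf_lt[_ [Y [PY ->]]] /ereal_inf_lt[_ [e [e0 ZY] <-]].
rewrite lte_fin lt_min => /andP[eD el].
have : (D / 4)%:E <= Sep Y (fun _ : 'I_N.+1 => k).
  apply: box_Sep_ge D0 _ Dz lz _ ZY; first by rewrite e0 ltW.
  move=> _; apply: (@le_trans _ _ (l / 2)%R); first by rewrite ge_min lexx.
  by lra.
move=> /le_trans /(_ (pyramid_Sep_ge _ PY)).
by rewrite leNgt Sn.
Qed.

End levy_limit_points.

(** * Finite spaces *)

Section finite_metrics.
Context (R : realType).

Lemma finite_enum (T : choiceType) : finite_set [set: T] ->
  exists (n : nat) (s : 'I_n -> T), forall t, exists i, s i = t.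
Proof.
move=> /finite_seqP[s sE].
exists (size s), (tnth (in_tuple s)) => t.
have /(tnthP (in_tuple s))[i ->] : t \in s by have : [set: T] t by []; rewrite sE.
by exists i.
Qed.

(** A ball of radius at most all positive finite distances is a single point. In [u] the value 1
    stands in for zero and for infinite distances, both of which [fine] sends to 0. *)
Lemma fin_emetric_complete (T : choiceType) (d : T -> T -> \bar R) :
  finite_set [set: T] -> (forall x y, 0 <= d x y) -> (forall x, d x x = 0) ->
  (forall x y, d x y = 0 -> x = y) ->
  forall F : set_system T, ProperFilter F ->
    (forall r : R, (0 < r)%R -> exists x, F [set y | d x y < r%:E]) ->
    exists l, forall r : R, (0 < r)%R -> F [set y | d l y < r%:E].
Proof.
move=> /finite_enum[n [s sT]] d_ge0 dxx d_eq F FF Fc.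
pose u (p : 'I_n * 'I_n) : R :=
  if (fine (d (s p.1) (s p.2)) == 0%R) then 1%R else fine (d (s p.1) (s p.2)).
have u0 p : (0 < u p)%R.
  by rewrite /u; case: ifPn => // p0; rewrite lt_neqAle eq_sym p0 fine_ge0.
have [r r0 ru] := exists_pos_lb u0.
have [x Fx] := Fc r r0; exists x => r' r'0.
apply: filterS Fx => y /= xy.
suff -> : y = x by rewrite dxx lte_fin.
have [[i ix] [j jy]] := (sT x, sT y).
apply/esym/d_eq; have := ru (i, j); rewrite /u /= ix jy.
move: xy (d_ge0 x y); case: (d x y) => [a||] //=.
rewrite !lte_fin lee_fin => ar a0; case: eqP => [->//|_].
by rewrite leNgt ar.
Qed.

Definition fin_emetric (T : choiceType) (d : T -> T -> \bar R)
    (fin : finite_set [set: T]) (d_ge0 : forall x y, 0 <= d x y)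
    (dxx : forall x, d x x = 0) (d_sym : forall x y, d x y = d y x)
    (d_tri : forall x y z, d x z <= d x y + d y z)
    (d_eq : forall x y, d x y = 0 -> x = y) : emetric R T :=
  EMetric d_ge0 dxx d_sym d_tri d_eq (fin_emetric_complete fin d_ge0 dxx d_eq).

Context (Z : extMmSpace R) (Zfin : finite_set [set: Z]).

Lemma finite_measurable (B : set Z) : @measurable _ (borel Z) B.
Proof.
apply: sub_sigma_algebra; rewrite -[B]setCK openC; apply: finite_closed.
exact: sub_finite_set Zfin.
Qed.

Lemma finite_atom (z : Z) : 0 < emm_measure Z [set z].
Proof.
apply: emm_full_support; last by exists z.
rewrite -[[set z]]setCK openC; apply: finite_closed; exact: sub_finite_set Zfin.
Qed.

Context (d : emetric R Z).

Let remet_meas (U : set (emcar d)) : open U ->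
  @measurable _ (borel Z) ((fun z : Z => z : emcar d) @^-1` U).
Proof. by move=> _; exact: finite_measurable. Qed.

Let remet_supp (x : emcar d) (r : R) : (0 < r)%R ->
  0 < emm_measure Z ((fun z : Z => z : emcar d) @^-1` [set y | d x y < r%:E]).
Proof.
move=> r0; apply: lt_le_trans (finite_atom x) _.
apply: le_measure; rewrite ?inE; try exact: finite_measurable.
by move=> _ -> /=; rewrite em_xx lte_fin.
Qed.

Let remet_sep : exists2 D : set (emcar d), countable D & dense D.
Proof.
exists setT; last by move=> U [x Ux] _; exists x.
exact: (finite_set_countable (T := Z)).
Qed.

Definition remet : extMmSpace R :=
  push_space (m := emm_measure Z) remet_meas remet_supp remet_sep.

Lemma remet_edist (x y : remet) : edist (x, y) = d x y.
Proof. exact: (edist_emcar (d := d)). Qed.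

Lemma remet_measure (B : set Z) : emm_measure remet B = emm_measure Z B.
Proof. by []. Qed.

Definition remet_mm (d_fin : forall x y, d x y < +oo) : mmSpace R.
Proof. by apply: (@MmSpace R remet) => x y; rewrite remet_edist. Defined.

End finite_metrics.

(** * Parameters of finite spaces *)

Section finite_parameter.
Context (R : realType) (W : extMmSpace R) (Wfin : finite_set [set: W]).

(** Number the points, take a quantile function of the resulting law on the line, and decode by
    [k]. *)
Lemma finite_parameter : exists phi : R -> W, is_parameter phi.
Proof.
have [n [s sW]] := finite_enum Wfin.
have [t tE] := choice sW.
pose h (w : W) : R := (t w : nat)%:R.
have h_inj : injective h.
  by move=> v w /eqP; rewrite eqr_nat => /eqP/val_inj tvw; rewrite -[v]tE -[w]tE tvw.
have h_meas : measurable_fun setT (h : borel W -> measurableTypeR R).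
  by move=> _ B _; exact: finite_measurable.
have h_bnd w : (0 <= h w <= n%:R)%R by rewrite ler0n ler_nat ltnW.
have [q [_ qE]] := exists_quantile (emm_measure W) h_meas h_bnd.
pose k (x : R) : W := if pselect (exists w, h w = x) is left e then projT1 (cid e) else point.
have hk w : k (h w) = w.
  rewrite /k; case: pselect => [e|[]]; last by exists w.
  by apply: h_inj; exact: projT2 (cid e).
have mfin (A : set (measurableTypeR R)) : finite_set A -> measurable A.
  move=> Afin; apply: countable_measurable; last exact: finite_set_countable.
  by move=> x; exact: measurable_set1.
have k_meas (B : set W) : @measurable _ (measurableTypeR R) (k @^-1` B).
  have -> : k @^-1` B = (h @` B) `|` (~` range h `&` [set _ | B point]).
    apply/seteqP; split=> x /=.
      rewrite /k; case: pselect => [e Be|e Be].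
        by left; exists (projT1 (cid e)) => //; exact: projT2 (cid e).
      by right; split=> // -[w _ wx]; apply: e; exists w.
    case=> [[w Bw <-]|[nx Bp]]; first by rewrite hk.
    by rewrite /k; case: pselect => // -[w wx]; case: nx; exists w.
  apply: measurableU.
    by apply: mfin; apply: finite_image; exact: sub_finite_set Wfin.
  apply: measurableI; first by apply: measurableC; apply: mfin; exact: finite_image.
  have [Bp|nBp] := pselect (B point).
    rewrite (_ : [set _ | B point] = setT); first exact: measurableT.
    by apply/seteqP; split.
  rewrite (_ : [set _ | B point] = set0); first exact: measurable0.
  by apply/seteqP; split.
exists (k \o q); split.
  move=> _ B _; exact: (@qt_measurable R q (@measurable_unitI R) _ (k_meas B)).
move=> B _; rewrite -[LHS](leb01E (q @^-1` (k @^-1` B))) qE //.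
by congr (emm_measure W _); apply/seteqP; split=> w /=; rewrite hk.
Qed.

End finite_parameter.

(** * The limit of an N-Levy family *)

Section maximal_space.
Context (R : realType).

Lemma extend_injection (T : eqType) (k : nat) (z : 'I_k -> T) (t : T) :
  injective z -> (forall i, z i <> t) -> exists v : 'I_k.+1 -> T, injective v.
Proof.
move=> z_inj zt.
exists (fun i => if unlift ord_max i is Some j then z j else t) => i j.
case: unliftP => [i' ->|->]; case: unliftP => [j' ->|->] //.
- by move=> /z_inj ->.
- by move=> /zt.
- by move=> /esym/zt.
Qed.

Lemma maximal_space (P : mmClass R) (N : nat) : is_pyramid P ->
  (forall (Y : mmSpace R) (y : 'I_N.+1 -> Y), P Y -> ~ injective y) ->
  exists (K : nat) (Z : mmSpace R) (z : 'I_K -> Z),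
    [/\ (K <= N)%N, P Z, injective z &
      forall (Y : mmSpace R) (y : 'I_K.+1 -> Y), P Y -> ~ injective y].
Proof.
move=> hP PN.
pose has k := `[< exists Z : mmSpace R, P Z /\ exists z : 'I_k -> Z, injective z >].
have has0 : exists k, has k.
  have [Z PZ] := pyr_nonempty hP; exists 0%N; apply/asboolP; exists Z; split=> //.
  by exists (fun=> point) => -[].
have hasN k : has k -> (k <= N)%N.
  move=> /asboolP[Z [PZ [z z_inj]]]; rewrite leqNgt; apply/negP => Nk.
  apply: (PN Z (fun i => z (widen_ord Nk i)) PZ) => i j /z_inj /(congr1 val) /=.
  exact: val_inj.
case: (ex_maxnP has0 hasN) => K hK Kmax.
have /asboolP[Z [PZ [z z_inj]]] := hK.
exists K, Z, z; split=> //; first exact: hasN.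
move=> Y y PY y_inj.
have /Kmax : has K.+1 by apply/asboolP; exists Y; split=> //; exists y.
by rewrite ltnn.
Qed.

End maximal_space.

Section limit_space.
Context (R : realType) (P : mmClass R) (hP : is_pyramid P).
Context (K : nat) (Z : mmSpace R) (z : 'I_K -> Z).
Hypotheses (PZ : P Z) (z_inj : injective z).
Hypothesis Kmax : forall (Y : mmSpace R) (y : 'I_K.+1 -> Y), P Y -> ~ injective y.

Lemma limit_surj (x : Z) : exists i, z i = x.
Proof.
apply: contrapT => H; have [|v v_inj] := @extend_injection Z K z x z_inj.
  by move=> i zx; apply: H; exists i.
exact: Kmax PZ v_inj.
Qed.

Lemma limit_finite : finite_set [set: Z].
Proof.
have -> : [set: Z] = range z.
  by apply/seteqP; split => // x _; have [i <-] := limit_surj x; exists i.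
by apply: finite_image; exact: finite_finset.
Qed.

Let finite_range (T : choiceType) (f : T -> Z) : finite_set (range f).
Proof. exact: sub_finite_set limit_finite. Qed.

(** Preimages of the [z i] are [K] points with at most one in each fibre; two points with the same
    image would leave room for one more. *)
Let max_injective (V : mmSpace R) (f : V -> Z) : P V ->
  (forall x, exists v, f v = x) -> injective f.
Proof.
move=> PV f_surj v v' fvv'; apply: contrapT => vv'.
have [g gE] := choice f_surj.
have gz_inj : injective (g \o z).
  by move=> i j /= gij; apply: z_inj; rewrite -(gE (z i)) gij gE.
have [t tg] : exists t, forall i, (g \o z) i <> t.
  have [[i iv]|nv] := pselect (exists i, g (z i) = v).
    exists v' => j /= jv'; apply: vv'; rewrite -iv -jv'; congr (g (z _)).
    by apply: z_inj; rewrite -(gE (z i)) -(gE (z j)) iv jv'.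
  by exists v => j /= jv; apply: nv; exists j.
have [y y_inj] := extend_injection gz_inj tg.
exact: Kmax PV y_inj.
Qed.

Let Zfin := limit_finite.

(** Finiteness belongs to the predicate because [P] speaks of mm-spaces, while [emetric] must also
    cover the limit. *)
Definition remet_in (d : emetric R Z) : Prop :=
  exists H : forall x y, d x y < +oo, P (remet_mm Zfin H).

(* By maximality of the number of points of [Z], a map of a common dominating
   space onto [Z] is a bijection and transports the larger metric to [Z]. *)
Lemma remet_step (d : emetric R Z) (W : mmSpace R) : remet_in d -> P W ->
  exists2 d', remet_in d' & (forall x y, d x y <= d' x y) /\
    dominates (remet Zfin d') W.
Proof.
move=> [dfin Pd] PW.
have [V [PV [f [f_lip fE]] [h [h_lip hE]]]] := pyr_directed hP Pd PW.
have f_surj : forall x, exists v, f v = x.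
  exact: (@dominates_surj R V (remet Zfin d) f (finite_range f) fE).
have f_inj : injective f by exact: max_injective PV f_surj.
have [g gE] := choice f_surj.
have fK v : g (f v) = v by apply: f_inj; rewrite gE.
have g_eq x y : edist (g x, g y) = 0 -> x = y.
  by move=> /emm_eq gxy; rewrite -(gE x) -(gE y) gxy.
have fEZ (B : set Z) : emm_measure V (f @^-1` B) = emm_measure Z B.
  exact: (fE B (finite_measurable (Z := remet Zfin d) Zfin B)).
pose d' : emetric R Z := @fin_emetric R Z (fun x y => edist (g x, g y)) Zfin
  (fun x y => edist_ge0 _) (fun x => edist_refl _) (fun x y => edist_sym _ _)
  (fun x y t => edist_triangle _ _ _) g_eq.
have d'_fin x y : d' x y < +oo by exact: mm_finite.
exists d'.
  exists d'_fin; apply: (pyr_down hP PV); exists f; split.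
    by move=> v w; rewrite remet_edist /= !fK.
  by move=> B _; exact: fEZ.
split.
  by move=> x y; have := f_lip (g x) (g y); rewrite remet_edist !gE.
exists (h \o g); split.
  by move=> x y; rewrite remet_edist /=; exact: h_lip.
move=> B mB; rewrite -hE // remet_measure -fEZ; congr (emm_measure V _).
by apply/seteqP; split=> v /=; rewrite fK.
Qed.

(* Domination compares metrics on [Z] only up to a permutation of [Z]; the sum
   [S] does not see the permutation, and [contract] keeps it finite in the
   limit. *)
Let S (d : Z -> Z -> \bar R) : R :=
  (\sum_(i < K) \sum_(j < K) contract (d (z i) (z j)))%R.

(** All terms of the difference of the sums are nonnegative, so the sum controls each distance
    separately. *)
Let S_diff (d d' : Z -> Z -> \bar R) (x y : Z) : (forall x y, d x y <= d' x y) ->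
  (contract (d' x y) - contract (d x y) <= S d' - S d)%R.
Proof.
move=> dd'; have [[i <-] [j <-]] := (limit_surj x, limit_surj y).
have c0 a b : (0 <= contract (d' (z a) (z b)) - contract (d (z a) (z b)))%R.
  by rewrite subr_ge0 le_contract.
rewrite /S -sumrB (bigD1 i) //= -sumrB (bigD1 j) //= -addrA lerDl addr_ge0 //.
  by apply: sumr_ge0.
apply: sumr_ge0 => a _; rewrite -sumrB; exact: sumr_ge0.
Qed.

Let S_le (d : Z -> Z -> \bar R) : (S d <= (K * K)%:R)%R.
Proof.
apply: (@le_trans _ _ (\sum_(i < K) \sum_(j < K) 1)%R).
  apply: ler_sum => i _; apply: ler_sum => j _.
  by apply: le_trans (ler_norm _) (contract_le1 _).
by rewrite !sumr_const !card_ord -mulrnA.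
Qed.

(** The dominating map is onto, hence permutes the finite set; reindexing along it compares the sums
    term by term. *)
Let S_dominates (d a : emetric R Z) :
  dominates (remet Zfin d) (remet Zfin a) -> (S a <= S d)%R.
Proof.
move=> [f [f_lip fE]].
have f_surj : forall x, exists v, f v = x.
  exact: (@dominates_surj R (remet Zfin d) (remet Zfin a) f (finite_range f) fE).
have [t tE] := choice (fun i => limit_surj (f (z i))).
have t_surj j : exists i, t i = j.
  have [v fv] := f_surj (z j); have [i iv] := limit_surj v.
  by exists i; apply: z_inj; rewrite tE iv fv.
have [u uE] := choice t_surj.
have u_inj : injective u by move=> i j uij; rewrite -(uE i) -(uE j) uij.
have t_inj : injective t.
  have [w uw wu] := injF_bij u_inj.
  by move=> i j; rewrite -(wu i) -(wu j) !uE => ->.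
rewrite /S (reindex_inj t_inj) /=; apply: ler_sum => i _.
rewrite (reindex_inj t_inj) /=; apply: ler_sum => j _.
by rewrite le_contract !tE; have := f_lip (z i) (z j); rewrite !remet_edist.
Qed.

Let Pi := {d : emetric R Z | remet_in d}.

Let Z_emetric : emetric R Z := @fin_emetric R Z (fun x y => edist (x, y)) Zfin
  (fun x y => edist_ge0 _) (fun x => edist_refl _) (fun x y => edist_sym _ _)
  (fun x y t => edist_triangle _ _ _) (fun x y => @emm_eq R Z x y).

Let Z_in : remet_in Z_emetric.
Proof.
exists (@mm_finite R Z); apply: (pyr_down hP PZ); exists id; split=> //.
by move=> x y; rewrite remet_edist.
Qed.

(** As [S (D n)] is within [1/(n+1)] of the supremum of [S], no larger metric in [P] can gain more
    than that in any contracted distance. *)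
Lemma maximizing_sequence : exists D : nat -> emetric R Z,
  [/\ forall n, remet_in (D n),
      forall m n, (m <= n)%N -> forall x y, D m x y <= D n x y &
      forall d, remet_in d -> forall n, (forall x y, D n x y <= d x y) ->
        forall x y, (contract (d x y) <= contract (D n x y) + n.+1%:R^-1)%R].
Proof.
pose E : set R := [set S d | d in [set d : emetric R Z | remet_in d]].
have E_sup : has_sup E.
  split; first by exists (S Z_emetric), Z_emetric; [exact: Z_in|].
  by exists (K * K)%:R => _ [d _ <-]; exact: S_le.
pose M := sup E.
have S_M d : remet_in d -> (S d <= M)%R.
  by move=> dP; apply: ub_le_sup; [case: E_sup|exists d].
(* A near-maximizer [a] need not lie above [d]; [remet_step] gives a metric that does and whose
   space dominates that of [a], so its sum is at least as large. *)
have next (nd : nat * Pi) : exists d' : Pi,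
    (forall x y, sval nd.2 x y <= sval d' x y) /\ (M - nd.1.+1%:R^-1 <= S (sval d'))%R.
  case: nd => n [d dP] /=.
  have [_ [a aP <-] Sa] : exists2 r, E r & (M - n.+1%:R^-1 < r)%R.
    by apply: sup_adherent => //; rewrite invr_gt0.
  case: (aP) => a_fin Pa.
  have [d' d'P [dd' d'a]] := remet_step dP Pa.
  exists (exist _ d' d'P); split=> //=.
  by apply: le_trans (ltW Sa) _; exact: S_dominates d'a.
have [F FP] := choice next.
pose fix D n : Pi := if n is m.+1 then F (n, D m) else F (0%N, exist _ _ Z_in).
have D_S n : (M - n.+1%:R^-1 <= S (sval (D n)))%R.
  by case: n => [|n] /=; [have [] := FP (0%N, exist _ _ Z_in)|have [] := FP (n.+1, D n)].
exists (fun n => sval (D n)); split.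
- by move=> n; exact: (svalP (D n)).
- move=> m n; elim: n => [|n IH]; first by rewrite leqn0 => /eqP ->.
  rewrite leq_eqVlt ltnS => /orP[/eqP -> //|mn] x y.
  by apply: le_trans (IH mn x y) _; have [] := FP (n.+1, D n).
- move=> d dP n Dd x y; rewrite addrC -lerBlDr; apply: le_trans (S_diff x y Dd) _.
  by rewrite lerBlDr (le_trans (S_M d dP)) // addrC -lerBlDr; exact: D_S.
Qed.

Context (D : nat -> emetric R Z).
Hypothesis D_in : forall n, remet_in (D n).
Hypothesis D_nd : forall m n, (m <= n)%N -> forall x y, D m x y <= D n x y.
Hypothesis D_max : forall d, remet_in d -> forall n, (forall x y, D n x y <= d x y) ->
  forall x y, (contract (d x y) <= contract (D n x y) + n.+1%:R^-1)%R.

Let e (x y : Z) : \bar R := ereal_sup (range (fun n => D n x y)).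

Let D_le_e n x y : D n x y <= e x y.
Proof. by apply: ereal_sup_ubound; exists n. Qed.

Let e_le x y t : (forall n, D n x y <= t) -> e x y <= t.
Proof. by move=> H; apply: ge_ereal_sup => _ [n _ <-]. Qed.

Let e_ge0 x y : 0 <= e x y.
Proof. exact: le_trans (em_ge0 _ _ _) (D_le_e 0%N x y). Qed.

Let e_xx x : e x x = 0.
Proof.
by apply/eqP; rewrite eq_le e_ge0 andbT; apply: e_le => n; rewrite em_xx.
Qed.

Let e_sym x y : e x y = e y x.
Proof. by congr ereal_sup; apply/seteqP; split=> _ [n _ <-]; exists n; rewrite // em_sym. Qed.

Let e_triangle x y t : e x t <= e x y + e y t.
Proof. by apply: e_le => n; apply: le_trans (em_triangle _ x y t) (leeD _ _). Qed.

Let e_eq x y : e x y = 0 -> x = y.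
Proof.
move=> exy; apply: (@em_eq _ _ (D 0%N)); apply/eqP.
by rewrite eq_le em_ge0 andbT -exy.
Qed.

Definition limit_emetric : emetric R Z :=
  fin_emetric Zfin e_ge0 e_xx e_sym e_triangle e_eq.

(** Above each [D n] some metric in [P] dominates [W] by a map [g n], and by near-maximality its
    contracted distances exceed those of [e] by at most [1/(n+1)]. A map that recurs for arbitrarily
    large [n] is 1-Lipschitz for [e]. *)
Lemma limit_dominates (W : mmSpace R) : P W -> dominates (remet Zfin limit_emetric) W.
Proof.
move=> PW.
have step n : exists g : Z -> W,
    (forall x y, (contract (edist (g x, g y)) <= contract (e x y) + n.+1%:R^-1)%R) /\
    (forall B : set (borel W), measurable B ->
      emm_measure Z (g @^-1` B) = emm_measure W B).
  have [d' d'_in [Dd' [g [g_lip gE]]]] := remet_step (D_in n) PW.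
  exists g; split; last exact: gE.
  move=> x y; apply: (@le_trans _ _ (contract (d' x y))).
    by rewrite le_contract; have := g_lip x y; rewrite remet_edist.
  by apply: le_trans (D_max d'_in Dd' x y) _; rewrite lerD2r le_contract.
have [g gP] := choice step.
have Wfin : finite_set (range (g 0%N)) by apply: finite_image; exact: limit_finite.
have g0_surj := dominates_surj Wfin (gP 0%N).2.
have [r rE] := choice g0_surj.
have [t tE] := choice limit_surj.
(* Since [g 0] is onto, [W] is covered by the images of the [z i], and [g n] can be encoded by a
   self-map of the index set. *)
pose tau n : {ffun 'I_K -> 'I_K} := [ffun i => t (r (g n (z i)))].
have tauE m n : tau m = tau n -> g m = g n.
  move=> mn; apply/funext => x; have [i <-] := limit_surj x.
  have : t (r (g m (z i))) = t (r (g n (z i))).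
    by move: mn => /ffunP/(_ i); rewrite !ffunE.
  by move=> /(congr1 z); rewrite !tE => /(congr1 (g 0%N)); rewrite !rE.
(* Some [g n] occurs infinitely often, the range of [tau] being finite. *)
have [n1 n1P] : exists n1, forall n0, exists2 n, (n0 <= n)%N & tau n = tau n1.
  apply: contrapT => H.
  have /choice[b bP] : forall c : {ffun 'I_K -> 'I_K}, exists b, forall n, (b <= n)%N -> tau n <> c.
    move=> c; apply: contrapT => nb.
    have ex n0 : exists2 n, (n0 <= n)%N & tau n = c.
      apply: contrapT => nn; apply: nb; exists n0 => n n0n tn; apply: nn; by exists n.
    have [m _ mc] := ex 0%N.
    by apply: H; exists m => n0; have [n ? ?] := ex n0; exists n; rewrite ?mc.
  pose b0 := \max_c b c.
  by apply: (bP (tau b0) b0); first exact: leq_bigmax.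
exists (g n1); split; last by have [] := gP n1.
move=> x y; rewrite remet_edist -le_contract; apply/ler_addgt0Pl => s s0.
pose n0 := Num.bound (s^-1)%R.
have [n n0n tn] := n1P n0.
have [gn _] := gP n; rewrite -(tauE _ _ tn); apply: le_trans (gn x y) _.
rewrite addrC lerD2r -[leRHS]invrK lef_pV2 ?posrE ?invr_gt0 //.
apply: le_trans (ltW (archi_boundP _)) _; first by rewrite invr_ge0 ltW.
by rewrite ler_nat; exact: leq_trans n0n _.
Qed.

(** Distances of [W] may equal the supremum [e] without being reached by any [D n]. Slightly shrunk
    copies of [W] do lie in [P], and [P] is closed. *)
Lemma limit_dominated (W : mmSpace R) : dominates (remet Zfin limit_emetric) W -> P W.
Proof.
move=> [f [f_lip fE]].
have fin_f : finite_set (range f) by apply: finite_image; exact: limit_finite.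
have f_surj := dominates_surj (X := remet Zfin limit_emetric) fin_f fE.
have Wfin : finite_set [set: W].
  by apply: sub_finite_set fin_f => w _; have [x <-] := f_surj w; exists x.
have [phi [phi_meas phiE]] := finite_parameter Wfin.
(* The number [l] acts as the reciprocal of a diameter bound; adding 1 to the distances avoids
   inverting 0. *)
have [l l0 lP] : exists2 l : R, (0 < l)%R & forall v w : W, (l * mm_dist v w <= 1)%R.
  have [|l l0 lz] := @exists_pos_lb R ('I_K * 'I_K)%type
      (fun p => (1 + mm_dist (f (z p.1)) (f (z p.2)))^-1)%R.
    by move=> p; rewrite invr_gt0 ltr_pwDl // mm_dist_ge0.
  exists l => // v w; have [[x <-] [y <-]] := (f_surj v, f_surj w).
  have [[i <-] [j <-]] := (limit_surj x, limit_surj y).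
  have p0 : (0 < 1 + mm_dist (f (z i)) (f (z j)))%R by rewrite ltr_pwDl // mm_dist_ge0.
  have := lz (i, j); rewrite /= -(ler_pM2r p0) mulVf ?gt_eqF // mulrDr mulr1.
  by move=> ?; lra.
apply: (pyr_closed hP) => s s0.
(* Shrinking changes distances by [th] times their value, at most [s / 2] by the choice of [l]; the
   bound 1/2 keeps the factor [1 - th] positive. *)
pose th : R := (Num.min (s / 2 * l) (1 / 2))%R.
have th0 : (0 < th)%R by rewrite lt_min mulr_gt0 // divr_gt0.
have th1 : (th < 1)%R.
  by apply: (@le_lt_trans _ _ (1 / 2)%R); [rewrite ge_min lexx orbT|lra].
have c0 : (0 < 1 - th)%R by rewrite subr_gt0.
(* The factor [1 - th] makes [dW] strictly smaller than the supremum [e], so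
   that it is already dominated at a finite stage of the sequence [D]. *)
pose dW (v w : W) : \bar R := (1 - th)%:E * edist (v, w).
have dWE v w : dW v w = ((1 - th) * mm_dist v w)%:E by rewrite /dW -mm_distE.
have dW_ge0 v w : 0 <= dW v w by rewrite dWE lee_fin mulr_ge0 ?mm_dist_ge0 // ltW.
have dWxx v : dW v v = 0 by rewrite dWE mm_distxx mulr0.
have dW_sym v w : dW v w = dW w v by rewrite /dW edist_sym.
have dW_tri v w u : dW v u <= dW v w + dW w u.
  by rewrite !dWE -EFinD lee_fin -mulrDr ler_pM2l // mm_dist_triangle.
have dW_eq v w : dW v w = 0 -> v = w.
  rewrite dWE => -[/eqP]; rewrite mulf_eq0 gt_eqF //= => /eqP vw.
  by apply: emm_eq; rewrite -mm_distE vw.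
pose d : emetric R W := fin_emetric Wfin dW_ge0 dWxx dW_sym dW_tri dW_eq.
have d_fin v w : d v w < +oo by rewrite /= dWE ltry.
pose Y := remet_mm Wfin d_fin.
exists Y; split; last first.
  have s20 : (0 < s / 2)%R by rewrite divr_gt0.
  apply: (@le_lt_trans _ _ (s / 2)%:E); last by rewrite lte_fin; lra.
  apply: box_le_ub; first exact: ltW.
  exists phi, (phi : R -> Y), (@unitI R); split=> //.
  - split.
      by move=> mI B _; apply: phi_meas => //; exact: finite_measurable.
    by move=> B _; apply: phiE; exact: finite_measurable.
  - by split; [exact: measurable_unitI|].
  - rewrite -[@unitI R]setIT -leb01E probability_setT lee_fin; lra.
  move=> a b _ _; have -> : @mm_dist R Y (phi a) (phi b) = ((1 - th) * mm_dist (phi a) (phi b))%R.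
    by apply: EFin_inj; rewrite mm_distE (remet_edist (Zfin := Wfin) (d := d)) /= dWE.
  have -> : (mm_dist (phi a) (phi b) - (1 - th) * mm_dist (phi a) (phi b)
      = th * mm_dist (phi a) (phi b))%R by ring.
  rewrite ger0_norm; last by apply: mulr_ge0; [exact: ltW|exact: mm_dist_ge0].
  apply: (@le_trans _ _ (s / 2 * l * mm_dist (phi a) (phi b))%R).
    by rewrite ler_wpM2r ?mm_dist_ge0 // ge_min lexx.
  by rewrite -mulrA -[leRHS]mulr1; apply: ler_wpM2l => //; exact: ltW.
have near x y : exists n, d (f x) (f y) <= D n x y.
  (* A zero distance does not become strictly smaller by shrinking, but any stage bounds it. *)
  have [fxy|fxy] := eqVneq (mm_dist (f x) (f y)) 0%R.
    by exists 0%N; rewrite /= dWE fxy mulr0 em_ge0.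
  have : d (f x) (f y) < e x y.
    have := f_lip x y; rewrite remet_edist; apply: lt_le_trans.
    rewrite /= dWE -mm_distE lte_fin.
    by rewrite gtr_pMl ?lt_neqAle 1?eq_sym ?fxy ?mm_dist_ge0 //; lra.
  by move=> /ereal_sup_gt[_ [n _ <-]] /ltW; exists n.
have [b bP] := choice (fun p : 'I_K * 'I_K => near (z p.1) (z p.2)).
pose n := \max_p b p.
have [D_fin PD] := D_in n.
apply: (pyr_down hP PD); exists f; split=> [x y|B mB].
  have [[i <-] [j <-]] := (limit_surj x, limit_surj y).
  rewrite (remet_edist (Zfin := Wfin) (d := d)) remet_edist; apply: le_trans (bP (i, j)) _.
  by apply: D_nd; exact: leq_bigmax.
exact: fE (finite_measurable Wfin B).
Qed.

End limit_space.

Theorem theorem5p6 (R : realType) (Pn : nat -> mmClass R)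
    (P : mmClass R) (N : nat)
    (hPn : forall n, is_pyramid (Pn n)) (hP : is_pyramid P)
    (hconv : weakly_converges Pn P) (hN : (1 <= N)%N) :
  levy_family N Pn <->
  (exists X : extMmSpace R, ([set: X] #<= `I_N)%card /\
    forall Y : mmSpace R, P Y <-> pyramid_of X Y).
Proof.
split=> [hL|[X [XN PX]]]; last first.
  by apply: (levy_of_finite hPn hconv XN) => Y /PX.
have [|K [Z [z [KN PZ z_inj Kmax]]]] := @maximal_space R P N hP.
  by move=> Y y PY; exact: card_levy_limit hPn hconv hL PY.
have [D [D_in D_nd D_max]] := maximizing_sequence hP PZ z_inj Kmax.
exists (remet (limit_finite PZ z_inj Kmax) (limit_emetric PZ z_inj Kmax D)); split.
  apply: card_le_trans (_ : (`I_K #<= `I_N)%card); last by rewrite card_le_II.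
  rewrite (card_le_eqr (@card_II K)).
  apply: card_le_trans (card_image_le z setT); apply: subset_card_le => x _.
  by have [i <-] := limit_surj PZ z_inj Kmax x; exists i.
move=> Y; split; first exact: limit_dominates.
exact: limit_dominated.
Qed.
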